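(* Let $P$ be a computable probability measure on the binary tree. Let $\omega$ be an infinite binary sequence that is Martin-Löf random with respect to $P$, and let $D=d(\omega\mid P)$. Then \[ \sum_{x\text{ a prefix of }\omega}\bigl(H(0\mid x)-P(0\mid x)\bigr)^2=O\Bigl((K(P)+D)\cdot 2^{\frac{3K(P)+D+O(1)}{2}}\Bigr), \] where the constants in $O(\cdot)$ do not depend on $P$ or $\omega$.
   Context: A measure on the binary tree is a function $P:\{0,1\}^*\to\mathbb{R}_{\ge 0}$ with rational values such that $P(\text{empty word})=1$ and $P(x0)+P(x1)=P(x)$ for every string $x$. It is computable if some algorithm outputs $P(x)$ on input $x$. Conditional probabilities are $P(b\mid x)=P(xb)/P(x)$. $K$ denotes prefix complexity, and $K(Q)$ for a computable measure $Q$ is the minimal prefix complexity of a program computing $Q$. Logarithms are binary. A semimeasure is a function $S:\{0,1\}^*\to\mathbb{R}_{\ge0}$ with $S(\text{empty word})\le 1$ and $S(x0)+S(x1)\le S(x)$ for every $x$. $M$ is a fixed universal lower semicomputable semimeasure, i.e. for every lower semicomputable semimeasure $S$ there is $c>0$ with $M(x)\ge cS(x)$ for all $x$. The a priori complexity is $KA(x)=\lceil -\log M(x)\rceil$. The randomness deficiency of a string is $d(x\mid P)=-\log P(x)-KA(x)$, and for an infinite sequence $d(\omega\mid P)=\sup_{x\text{ prefix of }\omega} d(x\mid P)$; it is finite for $P$-Martin-Löf random $\omega$. For a string $x$, a best explanation of $x$ is a computable measure $Q$ minimizing $3K(Q)-\log Q(x)$ over all computable measures; any one minimizer is chosen. The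 prediction is $H(b\mid x)=Q(xb)/Q(x)$ for this $Q$.
   Formalization: The factor K(P)+D is read as K(P)+D+O(1): for some universal M the deficiency D can be so negative that K(P)+D ≤ 0 while the sum is positive; for K(P)+D ≥ 1 the bound is the stated one. *)

(* Defs.v *)
From Stdlib Require Import Reals List Arith Lia.
Import ListNotations.
Open Scope R_scope.

Definition str := list bool.

Definition is_prefix (a b : str) : Prop := exists c, b = a ++ c.

Definition prefix (w : nat -> bool) (n : nat) : str := map w (seq 0 n).

(** Bijective encoding of binary strings as naturals:
    enc [] = 0, enc (b :: x) = 2 * enc x + b + 1. *)
Fixpoint enc (x : str) : nat :=
  match x with
  | [] => 0%nat
  | b :: y => S (2 * enc y + (if b then 1 else 0))%nat
  end.

(** * Model of computation: counter (Minsky) machines.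
    INC r : increment register r, go to next instruction.
    DEC r j : if register r is 0 jump to j, else decrement it and go on.
    The machine halts when the program counter leaves the program. *)
Inductive instr : Type :=
| INC (r : nat)
| DEC (r : nat) (j : nat).

Definition upd (regs : nat -> nat) (r v : nat) : nat -> nat :=
  fun k => if Nat.eqb k r then v else regs k.

Fixpoint exec (p : list instr) (fuel pc : nat) (regs : nat -> nat)
  : option (nat -> nat) :=
  match nth_error p pc with
  | None => Some regs
  | Some i =>
      match fuel with
      | O => None
      | S f =>
          match i with
          | INC r => exec p f (S pc) (upd regs r (S (regs r)))
          | DEC r j =>
              match regs r with
              | O => exec p f j regs
              | S v => exec p f (S pc) (upd regs r v)
              end
          end
      end
  end.

Definition init (l : list nat) : nat -> nat := fun r => nth r l 0%nat.

(** Programs are binary strings, decoded into counter programs: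
    a natural n is written in unary 1^n 0; an instruction is
    0 <r> (INC r) or 1 <r> <j> (DEC r j).  Parsing stops at the first
    incomplete instruction. *)
Fixpoint read_unary (fuel : nat) (s : str) : option (nat * str) :=
  match fuel with
  | O => None
  | S f =>
      match s with
      | [] => None
      | false :: t => Some (0%nat, t)
      | true :: t =>
          match read_unary f t with
          | Some (n, t') => Some (S n, t')
          | None => None
          end
      end
  end.

Fixpoint decode_aux (fuel : nat) (s : str) : list instr :=
  match fuel with
  | O => []
  | S f =>
      match s with
      | [] => []
      | false :: t =>
          match read_unary (length t) t with
          | Some (r, t') => INC r :: decode_aux f t'
          | None => []
          end
      | true :: t =>
          match read_unary (length t) t with
          | Some (r, t') =>
              match read_unary (length t') t' with
              | Some (j, t'') => DEC r j :: decode_aux f t''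
              | None => []
              end
          | None => []
          end
      end
  end.

Definition decode (s : str) : list instr := decode_aux (length s) s.

Definition runs (q : str) (l : list nat) (regs : nat -> nat) : Prop :=
  exists fuel, exec (decode q) fuel 0 (init l) = Some regs.

Definition outputs (m p y : str) : Prop :=
  exists regs, runs m [enc p] regs /\ regs 0%nat = enc y.

Definition halts (m p : str) : Prop := exists y, outputs m p y.

Definition PrefixFree (m : str) : Prop :=
  forall p q, halts m p -> halts m q -> is_prefix p q -> p = q.

Definition OptimalPrefix (U : str) : Prop :=
  PrefixFree U /\
  forall V, PrefixFree V -> exists c : nat,
    forall x p, outputs V p x ->
      exists p', outputs U p' x /\ (length p' <= length p + c)%nat.

Definition KIs (U x : str) (k : nat) : Prop :=
  (exists p, outputs U p x /\ length p = k) /\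
  (forall p, outputs U p x -> (k <= length p)%nat).

Definition IsMeasure (Q : str -> R) : Prop :=
  Q [] = 1 /\
  (forall x, 0 <= Q x) /\
  (forall x, exists a b : nat, (0 < b)%nat /\ Q x = INR a / INR b) /\
  (forall x, Q (x ++ [false]) + Q (x ++ [true]) = Q x).

Definition computes (q : str) (Q : str -> R) : Prop :=
  forall x, exists regs, runs q [enc x] regs /\ (0 < regs 1%nat)%nat /\
    Q x = INR (regs 0%nat) / INR (regs 1%nat).

Definition ComputableMeasure (Q : str -> R) : Prop :=
  IsMeasure Q /\ exists q, computes q Q.

Definition KMeasIs (U : str) (Q : str -> R) (k : nat) : Prop :=
  (exists q, computes q Q /\ KIs U q k) /\
  (forall q k', computes q Q -> KIs U q k' -> (k <= k')%nat).

Definition Semimeasure (S : str -> R) : Prop :=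
  (forall x, 0 <= S x) /\ S [] <= 1 /\
  (forall x, S (x ++ [false]) + S (x ++ [true]) <= S x).

Definition LowerSemicomputable (Sm : str -> R) : Prop :=
  exists (q : str) (a : str -> nat -> R),
    (forall x n, exists regs, runs q [enc x; n] regs /\ (0 < regs 1%nat)%nat /\
        a x n = INR (regs 0%nat) / INR (regs 1%nat)) /\
    (forall x n, a x n <= a x (S n)) /\
    (forall x, is_lub (fun r => exists n, r = a x n) (Sm x)).

Definition UniversalSemimeasure (M : str -> R) : Prop :=
  Semimeasure M /\ LowerSemicomputable M /\
  forall S, Semimeasure S -> LowerSemicomputable S ->
    exists c, 0 < c /\ forall x, c * S x <= M x.

Definition log2 (x : R) : R := ln x / ln 2.

(** ceiling: 1 - up(-y) is the least integer >= y *)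
Definition Rceil (y : R) : Z := (1 - up (- y))%Z.

Definition KA (M : str -> R) (x : str) : Z := Rceil (- log2 (M x)).

Definition defic (M P : str -> R) (x : str) : R :=
  - log2 (P x) - IZR (KA M x).

Definition inW (t : str) (n : nat) (x : str) : Prop :=
  exists regs, runs t [n; enc x] regs.

(** t is a Martin-Löf test for P: P(U_n) <= 2^-n where U_n is the open set
    generated by W_n; measured through finite prefix-free subsets. *)
Definition MLTest (P : str -> R) (t : str) : Prop :=
  forall (n : nat) (L : list str),
    NoDup L ->
    (forall a b, In a L -> In b L -> is_prefix a b -> a = b) ->
    (forall a, In a L -> inW t n a) ->
    fold_right Rplus 0 (map P L) <= (/ 2) ^ n.

Definition MLRandom (P : str -> R) (w : nat -> bool) : Prop :=
  forall t, MLTest P t -> exists n, forall m, ~ inW t n (prefix w m).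

Definition BestExplanation (U : str) (x : str) (Q : str -> R) : Prop :=
  ComputableMeasure Q /\ 0 < Q x /\
  exists kQ, KMeasIs U Q kQ /\
    forall Q' kQ', ComputableMeasure Q' -> KMeasIs U Q' kQ' -> 0 < Q' x ->
      3 * INR kQ - log2 (Q x) <= 3 * INR kQ' - log2 (Q' x).

(* Main.v *)
(** Let Q be the best explanation of a prefix x of w, of complexity k.  Mixing
    all computable measures with the weights [2^-k] gives [M x >= c 2^-k Q(x)];
    comparing Q with P as an explanation of x then yields
    [2 k <= 3 K(P) + D + O(1)], which bounds the number of different Q.

    For a single Q, let A be the semimeasure whose conditional probabilities
    are the means of those of P and Q.  For conditional probabilities a, b of
    the same symbol, [ln (((a+b)/2)^2 / (a b)) >= (a-b)^2 / 4], and for a binary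
    alphabet the deviation does not depend on the symbol; so the deviations
    along x add up to at most [4 ln (A(x)^2 / (P(x) Q(x)))].  This is
    O(K(P) + D) since [M x >= c 2^-(K(P)+k) A(x)] and
    [P(x) / Q(x) <= 2^(3 K(P) - 3 k)].

    Both lower bounds on M come from one lower semicomputable mixture over
    pairs (p, p') of programs, where the pairs (p, p) get weight [2^-|p|]
    instead of [2^-2|p|]: for P = Q the semimeasure A is Q itself.  Its rational
    approximations are primitive recursive, and primitive recursive functions
    are compiled to counter machines. *)
Require Import Defs.
From Stdlib Require Import Reals List Arith Lia Lra Cantor.
From Stdlib Require Import FunctionalExtensionality IndefiniteDescription.
Import ListNotations.
Open Scope nat_scope.

(** * Structured programs for counter machines *)

(** The weight of the diagonal pairs decides the exponent. With [2^-2|p|] the comparison of Q with P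
    would only give [k <= 3 K(P) + D + O(1)]; with [2^-|p|] it bounds [2 k], and fewer than
    [2^(m+1)] programs have length at most m. The coefficient 3 pays for A: the term [A(x)^2] costs
    [2 k], and [log (P(x) / Q(x)) <= 3 K(P) - 3 k] absorbs it, so the bound for a single Q is free
    of k.

    It is undecidable which programs compute measures. The mixture therefore runs over all programs
    of [U], and a term moves past a node only after the values at the node and its two children have
    been computed and found additive. Thus every finite stage is already a semimeasure, whatever the
    programs do.

    A best explanation of x controls the deviations at proper prefixes of x only. The prefixes are
    grouped by the program of their explanation; the longest member of a group controls all the
    others, and its own deviation is counted as at most 1. *)

Lemma upd_same s r v : upd s r v r = v.
Proof. unfold upd. now rewrite Nat.eqb_refl. Qed.

Lemma upd_other s r v k : k <> r -> upd s r v k = s k.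
Proof. intros H. unfold upd. now rewrite (proj2 (Nat.eqb_neq k r) H). Qed.

Ltac upd_solve :=
  unfold upd; repeat (match goal with
  | |- context [Nat.eqb ?a ?b] => destruct (Nat.eqb_spec a b)
  | H : context [Nat.eqb ?a ?b] |- _ => destruct (Nat.eqb_spec a b)
  end); subst; try lia; auto; try (cbn [Nat.add] in *; lia).

Ltac state_eq := apply functional_extensionality; intro; upd_solve.

(** Test and decrement stay fused in [If] and [While], as in [DEC], so each of them compiles to one
    conditional [DEC] and one jump. *)
Inductive com : Type :=
| Skip
| Inc (r : nat)
| Seq (c1 c2 : com)
| If (r : nat) (c1 c2 : com)
| While (r : nat) (c : com).

Inductive ceval : com -> (nat -> nat) -> (nat -> nat) -> Prop :=
| ESkip s : ceval Skip s s
| EInc r s : ceval (Inc r) s (upd s r (S (s r)))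
| ESeq c1 c2 s1 s2 s3 :
    ceval c1 s1 s2 -> ceval c2 s2 s3 -> ceval (Seq c1 c2) s1 s3
| EIfS r c1 c2 s v s' :
    s r = S v -> ceval c1 (upd s r v) s' -> ceval (If r c1 c2) s s'
| EIfO r c1 c2 s s' : s r = 0 -> ceval c2 s s' -> ceval (If r c1 c2) s s'
| EWhileO r c s : s r = 0 -> ceval (While r c) s s
| EWhileS r c s v s1 s' :
    s r = S v -> ceval c (upd s r v) s1 -> ceval (While r c) s1 s' ->
    ceval (While r c) s s'.

Fixpoint csize (c : com) : nat :=
  match c with
  | Skip => 0
  | Inc _ => 1
  | Seq c1 c2 => csize c1 + csize c2
  | If _ c1 c2 => 2 + csize c1 + csize c2
  | While _ c => 2 + csize c
  end.

(** A crude sum in place of a maximum: every register from [cbound c] on is untouched by [c] and can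
    serve as [z]. *)
Fixpoint cbound (c : com) : nat :=
  match c with
  | Skip => 0
  | Inc r => S r
  | Seq c1 c2 => cbound c1 + cbound c2
  | If r c1 c2 => S r + cbound c1 + cbound c2
  | While r c => S r + cbound c
  end.

(** [o] is the address of the first instruction; [z] is a register that stays
    zero, so that [DEC z j] is an unconditional jump. *)
Fixpoint compile (z o : nat) (c : com) : list instr :=
  match c with
  | Skip => []
  | Inc r => [INC r]
  | Seq c1 c2 => compile z o c1 ++ compile z (o + csize c1) c2
  | If r c1 c2 =>
      DEC r (o + csize c1 + 2) :: compile z (S o) c1
      ++ DEC z (o + csize c1 + 2 + csize c2) :: compile z (o + csize c1 + 2) c2
  | While r c => DEC r (o + csize c + 2) :: compile z (S o) c ++ [DEC z o]
  end.

Lemma compile_length z c : forall o, length (compile z o c) = csize c.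
Proof.
  induction c; intro o; simpl; auto; repeat (rewrite length_app; simpl);
    rewrite ?IHc, ?IHc1, ?IHc2; lia.
Qed.

Definition code_at (p : list instr) (o : nat) (l : list instr) : Prop :=
  exists pre post, p = pre ++ l ++ post /\ length pre = o.

Lemma code_at_app p o l1 l2 :
  code_at p o (l1 ++ l2) -> code_at p o l1 /\ code_at p (o + length l1) l2.
Proof.
  intros (pre & post & -> & <-). split.
  - exists pre, (l2 ++ post). now rewrite <- app_assoc.
  - exists (pre ++ l1), post. now rewrite length_app, <- !app_assoc.
Qed.

Lemma code_at_cons p o i l :
  code_at p o (i :: l) -> nth_error p o = Some i /\ code_at p (S o) l.
Proof.
  intros (pre & post & -> & <-). split.
  - rewrite nth_error_app2, Nat.sub_diag by lia. reflexivity.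
  - exists (pre ++ [i]), post. rewrite length_app, <- app_assoc. simpl.
    split; [reflexivity | lia].
Qed.

(** Quantifying over all leftover fuel makes runs composable, and it also transfers divergence from
    the later state to the earlier one. *)
Definition reach p pc s pc' s' : Prop :=
  exists k, forall f, exec p (k + f) pc s = exec p f pc' s'.

Lemma reach_refl p pc s : reach p pc s pc s.
Proof. now exists 0. Qed.

Lemma reach_trans p pc1 s1 pc2 s2 pc3 s3 :
  reach p pc1 s1 pc2 s2 -> reach p pc2 s2 pc3 s3 -> reach p pc1 s1 pc3 s3.
Proof.
  intros [k1 H1] [k2 H2]. exists (k1 + k2). intro f.
  now rewrite <- Nat.add_assoc, H1, H2.
Qed.

Lemma reach_inc p pc r s :
  nth_error p pc = Some (INC r) -> reach p pc s (S pc) (upd s r (S (s r))).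
Proof. intro H. exists 1. intro f. simpl. now rewrite H. Qed.

Lemma reach_dec_O p pc r j s :
  nth_error p pc = Some (DEC r j) -> s r = 0 -> reach p pc s j s.
Proof. intros H Hr. exists 1. intro f. simpl. now rewrite H, Hr. Qed.

Lemma reach_dec_S p pc r j s v :
  nth_error p pc = Some (DEC r j) -> s r = S v ->
  reach p pc s (S pc) (upd s r v).
Proof. intros H Hr. exists 1. intro f. simpl. now rewrite H, Hr. Qed.

Lemma ceval_frame c s s' z : ceval c s s' -> cbound c <= z -> s' z = s z.
Proof.
  induction 1; simpl in *; intro Hz; auto.
  - rewrite upd_other; lia.
  - rewrite IHceval2, IHceval1; lia.
  - rewrite IHceval, upd_other; lia.
  - rewrite IHceval; lia.
  - rewrite IHceval2, IHceval1, upd_other; lia.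
Qed.

(** Induction on the derivation of [ceval], since loops are not bounded by the syntax. [ceval_frame]
    keeps [z] at zero, so each [DEC z] jumps. *)
Lemma compile_correct c s s' :
  ceval c s s' -> forall z p o, cbound c <= z -> s z = 0 ->
  code_at p o (compile z o c) -> reach p o s (o + csize c) s'.
Proof.
  induction 1; intros z p o Hb Hz Hc; simpl in Hb.
  - simpl. rewrite Nat.add_0_r. apply reach_refl.
  - simpl in *. apply code_at_cons in Hc as [Hc _].
    rewrite Nat.add_1_r. now apply reach_inc.
  - simpl in *. apply code_at_app in Hc as [Hc1 Hc2].
    rewrite compile_length in Hc2.
    eapply reach_trans; [apply (IHceval1 z); auto; lia|].
    rewrite Nat.add_assoc. apply (IHceval2 z); auto; [lia|].
    rewrite (ceval_frame _ _ _ z H); auto; lia.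
  - simpl in *. apply code_at_cons in Hc as [Hi Hc].
    apply code_at_app in Hc as [Hc1 Hc2]. rewrite compile_length in Hc2.
    apply code_at_cons in Hc2 as [Hj _].
    eapply reach_trans; [eapply reach_dec_S; eauto|].
    eapply reach_trans; [apply (IHceval z); auto; [lia | rewrite upd_other; lia]|].
    replace (o + S (S (csize c1 + csize c2)))
      with (o + csize c1 + 2 + csize c2) by lia.
    apply (reach_dec_O _ _ z); auto.
    rewrite (ceval_frame _ _ _ z H0), upd_other; lia.
  - simpl in *. apply code_at_cons in Hc as [Hi Hc].
    apply code_at_app in Hc as [Hc1 Hc2]. rewrite compile_length in Hc2.
    apply code_at_cons in Hc2 as [_ Hc2].
    eapply reach_trans; [eapply reach_dec_O; eauto|].
    replace (S (S o + csize c1)) with (o + csize c1 + 2) in Hc2 by lia.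
    replace (o + S (S (csize c1 + csize c2)))
      with (o + csize c1 + 2 + csize c2) by lia.
    apply (IHceval z); auto; lia.
  - simpl in *. apply code_at_cons in Hc as [Hi _].
    replace (o + S (S (csize c))) with (o + csize c + 2) by lia.
    eapply reach_dec_O; eauto.
  - assert (Hc' := Hc). simpl in Hc'. apply code_at_cons in Hc' as [Hi Hc'].
    apply code_at_app in Hc' as [Hc1 Hc2]. rewrite compile_length in Hc2.
    apply code_at_cons in Hc2 as [Hj _].
    assert (Hs1 : s1 z = 0) by (rewrite (ceval_frame _ _ _ z H0), upd_other; lia).
    eapply reach_trans; [eapply reach_dec_S; eauto|].
    eapply reach_trans; [apply (IHceval1 z); auto; [lia | rewrite upd_other; lia]|].
    eapply reach_trans; [apply (reach_dec_O _ _ z); eauto|].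
    apply (IHceval2 z); auto.
Qed.

Definition unary (n : nat) : str := repeat true n ++ [false].

Fixpoint encode (p : list instr) : str :=
  match p with
  | [] => []
  | INC r :: p' => false :: unary r ++ encode p'
  | DEC r j :: p' => true :: unary r ++ unary j ++ encode p'
  end.

Lemma read_unary_unary n : forall f t, n < f -> read_unary f (unary n ++ t) = Some (n, t).
Proof.
  induction n; intros [|f] t H; try lia; simpl; auto.
  fold (unary n). now rewrite IHn by lia.
Qed.

Lemma unary_length n : length (unary n) = S n.
Proof. unfold unary. rewrite length_app, repeat_length. simpl. lia. Qed.

Lemma encode_length p : length p <= length (encode p).
Proof.
  induction p as [|[r|r j] p IH]; simpl; auto;
    rewrite !length_app; lia.
Qed.

Lemma decode_encode p : decode (encode p) = p.
Proof.
  unfold decode.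
  enough (forall f, length p <= f -> decode_aux f (encode p) = p)
    by (apply H, encode_length).
  induction p as [|[r|r j] p IH]; intros [|f] H; simpl in *; try lia; auto.
  - rewrite read_unary_unary, IH; auto; try lia.
    rewrite length_app, unary_length. lia.
  - rewrite read_unary_unary.
    + rewrite read_unary_unary, IH; auto; try lia.
      rewrite length_app, unary_length. lia.
    + rewrite length_app, unary_length. lia.
Qed.

Lemma exec_end p f pc s : length p <= pc -> exec p f pc s = Some s.
Proof.
  intro H. apply nth_error_None in H. destruct f; simpl; now rewrite H.
Qed.

(** * Primitive recursive functions on codes *)

Lemma ceval_eq c s s1 s2 : ceval c s s1 -> s1 = s2 -> ceval c s s2.
Proof. now intros H <-. Qed.

Definition clear r := While r Skip.

Lemma clear_correct r s : ceval (clear r) s (upd s r 0).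
Proof.
  remember (s r) as n eqn:Hn. revert s Hn. induction n; intros s Hn.
  - eapply ceval_eq; [apply EWhileO; auto | state_eq].
  - eapply EWhileS; [eauto | apply ESkip|].
    eapply ceval_eq; [apply IHn; now rewrite upd_same | state_eq].
Qed.

Definition move a b := While a (Inc b).

Lemma move_correct a b s :
  a <> b -> ceval (move a b) s (upd (upd s a 0) b (s a + s b)).
Proof.
  intro Hab. remember (s a) as n eqn:Hn. revert s Hn. induction n; intros s Hn.
  - eapply ceval_eq; [apply EWhileO; auto | state_eq].
  - eapply EWhileS; [eauto | apply EInc|].
    eapply ceval_eq; [apply IHn; upd_solve | state_eq].
Qed.

Definition move2 a b c := While a (Seq (Inc b) (Inc c)).

Lemma move2_correct a b c s :
  a <> b -> a <> c -> b <> c ->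
  ceval (move2 a b c) s (upd (upd (upd s a 0) b (s a + s b)) c (s a + s c)).
Proof.
  intros Hab Hac Hbc. remember (s a) as n eqn:Hn. revert s Hn.
  induction n; intros s Hn.
  - eapply ceval_eq; [apply EWhileO; auto | state_eq].
  - eapply EWhileS; [eauto | eapply ESeq; apply EInc|].
    eapply ceval_eq; [apply IHn; upd_solve | state_eq].
Qed.

(** Cantor's code of (x, y) is [y + tri (x + y)]. Register [d] first becomes x + y and [2 + d]
    starts from y; each pass adds to [2 + d] the value that [d] had before its decrement. *)
Definition pair_com d :=
  Seq (move2 (1 + d) d (2 + d))
  (Seq (While d (Seq (Inc (2 + d))
                (Seq (move2 d (1 + d) (2 + d)) (move (1 + d) d))))
       (move (2 + d) d)).

Definition tri n := nat_rec (fun _ => nat) 0 (fun i m => S i + m) n.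

Lemma pair_com_correct d s :
  (forall k, S d < k -> s k = 0) ->
  ceval (pair_com d) s (upd (upd s (S d) 0) d (to_nat (s d, s (S d)))).
Proof.
  intro Hs.
  assert (Hloop : forall t s, s d = t -> s (1 + d) = 0 ->
    ceval (While d (Seq (Inc (2 + d))
             (Seq (move2 d (1 + d) (2 + d)) (move (1 + d) d))))
      s (upd (upd s d 0) (2 + d) (s (2 + d) + tri t))).
  { clear. induction t; intros s Hd H1.
    - eapply ceval_eq; [now apply EWhileO | simpl; state_eq].
    - eapply EWhileS; [eauto | |].
      + eapply ESeq; [apply EInc|].
        eapply ESeq; [apply move2_correct; lia | apply move_correct; lia].
      + eapply ceval_eq; [apply IHt; upd_solve | simpl; state_eq]. }
  eapply ESeq; [apply move2_correct; lia|].
  eapply ESeq; [apply Hloop; [reflexivity | upd_solve]|].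
  eapply ceval_eq; [apply move_correct; lia|].
  change (to_nat (s d, s (S d))) with (s (S d) + tri (s (S d) + s d)).
  pose proof (Hs (2 + d)) as H2. unfold upd. rewrite Nat.eqb_refl.
  apply functional_extensionality; intro k.
  repeat match goal with
  | |- context [Nat.eqb ?a ?b] => destruct (Nat.eqb_spec a b); try lia
  end; subst; simpl in *; try lia.
Qed.

(** Counts up from the pair (0, 0), one step along the antidiagonals per pass, following the
    recurrence [of_nat_S]. *)
Definition unpair_com d :=
  Seq (While d (If (1 + d) (Inc (2 + d))
                           (Seq (Inc (1 + d)) (move (2 + d) (1 + d)))))
  (Seq (move (1 + d) d) (move (2 + d) (1 + d))).

Lemma of_nat_S n :
  of_nat (S n) = match fst (of_nat n) with
                 | 0 => (S (snd (of_nat n)), 0)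
                 | S x => (x, S (snd (of_nat n)))
                 end.
Proof. simpl. destruct (of_nat n) as [[|x] y]; reflexivity. Qed.

Lemma unpair_com_correct d s :
  (forall k, d < k -> s k = 0) ->
  ceval (unpair_com d) s
    (upd (upd s d (fst (of_nat (s d)))) (S d) (snd (of_nat (s d)))).
Proof.
  intro Hs.
  (* [m] is the number of steps already made and [n] the number still to make. *)
  assert (Hloop : forall n m s, s d = n -> s (1 + d) = fst (of_nat m) ->
    s (2 + d) = snd (of_nat m) ->
    ceval (While d (If (1 + d) (Inc (2 + d))
                           (Seq (Inc (1 + d)) (move (2 + d) (1 + d)))))
      s (upd (upd (upd s d 0) (1 + d) (fst (of_nat (n + m))))
             (2 + d) (snd (of_nat (n + m))))).
  { clear. induction n; intros m s Hd H1 H2.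
    - eapply ceval_eq; [now apply EWhileO | simpl plus; state_eq].
    - replace (S n + m) with (n + S m) by lia.
      assert (H := of_nat_S m). rewrite <- H1, <- H2 in H.
      destruct (s (1 + d)) as [|x] eqn:E.
      + eapply EWhileS; [eauto | eapply EIfO|].
        * rewrite upd_other by lia; auto.
        * eapply ESeq; [apply EInc | apply move_correct; lia].
        * eapply ceval_eq; [apply (IHn (S m)); rewrite ?H; simpl fst; simpl snd; upd_solve | state_eq].
      + eapply EWhileS; [eauto | eapply EIfS|].
        * rewrite upd_other by lia; eauto.
        * apply EInc.
        * eapply ceval_eq; [apply (IHn (S m)); rewrite ?H; simpl fst; simpl snd; upd_solve | state_eq]. }
  eapply ESeq; [apply (Hloop (s d) 0); [reflexivity | apply Hs; lia ..]|].
  rewrite Nat.add_0_r.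
  eapply ESeq; [apply move_correct; lia|].
  eapply ceval_eq; [apply move_correct; lia|].
  pose proof (Hs (2 + d)) as H2.
  state_eq.
Qed.

(** Unary functions on [nat], several arguments being paired by [to_nat];
    [Iter f] maps the pair [(n, a)] to [f^n a]. *)
Inductive comb : Type :=
| Zero | Succ | Id | Fst | Snd
| Pair (f g : comb) | Comp (f g : comb) | Iter (f : comb).

Fixpoint ev (f : comb) (n : nat) : nat :=
  match f with
  | Zero => 0
  | Succ => S n
  | Id => n
  | Fst => fst (of_nat n)
  | Snd => snd (of_nat n)
  | Pair f g => to_nat (ev f n, ev g n)
  | Comp f g => ev f (ev g n)
  | Iter f => Nat.iter (fst (of_nat n)) (ev f) (snd (of_nat n))
  end.

(** Stack discipline: the argument sits in register [d], everything above is zero before and after,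
    everything below is untouched, and subcomputations run at [1 + d]. In [Pair], each triple of
    moves swaps [d] and [1 + d] through [2 + d]. *)
Fixpoint com_of (f : comb) (d : nat) : com :=
  match f with
  | Zero => clear d
  | Succ => Inc d
  | Id => Skip
  | Fst => Seq (unpair_com d) (clear (1 + d))
  | Snd => Seq (unpair_com d) (Seq (clear d) (move (1 + d) d))
  | Pair f g =>
      Seq (move2 d (1 + d) (2 + d)) (Seq (move (2 + d) d)
      (Seq (com_of g (1 + d))
      (Seq (move d (2 + d)) (Seq (move (1 + d) d) (Seq (move (2 + d) (1 + d))
      (Seq (com_of f (1 + d))
      (Seq (move d (2 + d)) (Seq (move (1 + d) d) (Seq (move (2 + d) (1 + d))
      (pair_com d))))))))))
  | Comp f g => Seq (com_of g d) (com_of f d)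
  | Iter f =>
      Seq (unpair_com d) (Seq (While d (com_of f (1 + d))) (move (1 + d) d))
  end.

Ltac zeros Hs :=
  let k := fresh "k" in let Hk := fresh "Hk" in
  intros k Hk; pose proof (Hs k); upd_solve.

Ltac state_eq_with Hs d :=
  pose proof (Hs (1 + d)); pose proof (Hs (2 + d));
  apply functional_extensionality; intro; upd_solve.

Lemma com_of_correct f : forall d s,
  (forall k, d < k -> s k = 0) -> ceval (com_of f d) s (upd s d (ev f (s d))).
Proof.
  induction f; intros d s Hs; simpl com_of; simpl ev.
  - apply clear_correct.
  - apply EInc.
  - eapply ceval_eq; [apply ESkip | state_eq].
  - eapply ESeq; [now apply unpair_com_correct|].
    eapply ceval_eq; [apply clear_correct | state_eq_with Hs d].
  - eapply ESeq; [now apply unpair_com_correct|].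
    eapply ESeq; [apply clear_correct|].
    eapply ceval_eq; [apply move_correct; lia | state_eq_with Hs d].
  - assert (H1 := Hs (1 + d) ltac:(lia)). assert (H2 := Hs (2 + d) ltac:(lia)).
    set (v := s d).
    eapply ESeq; [apply move2_correct; lia|].
    eapply ESeq; [apply move_correct; lia|].
    match goal with |- ceval _ ?s0 _ => replace s0 with (upd s (1 + d) v) end.
    2: unfold v; state_eq.
    eapply ESeq; [apply IHf2; zeros Hs|].
    rewrite upd_same.
    do 2 (eapply ESeq; [apply move_correct; lia|]).
    eapply ESeq; [apply move_correct; lia|].
    match goal with |- ceval _ ?s0 _ =>
      replace s0 with (upd (upd s d (ev f2 v)) (1 + d) v) end.
    2: unfold v; state_eq.
    eapply ESeq; [apply IHf1; zeros Hs|].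
    rewrite upd_same.
    do 2 (eapply ESeq; [apply move_correct; lia|]).
    eapply ESeq; [apply move_correct; lia|].
    match goal with |- ceval _ ?s0 _ =>
      replace s0 with (upd (upd s d (ev f1 v)) (1 + d) (ev f2 v)) end.
    2: unfold v; state_eq.
    eapply ceval_eq; [apply pair_com_correct; zeros Hs|].
    replace (upd (upd s d (ev f1 v)) (1 + d) (ev f2 v) d) with (ev f1 v)
      by (unfold v; upd_solve).
    replace (upd (upd s d (ev f1 v)) (1 + d) (ev f2 v) (S d)) with (ev f2 v)
      by (unfold v; upd_solve).
    state_eq.
  - eapply ESeq; [now apply IHf2|].
    eapply ceval_eq; [apply IHf1; zeros Hs|].
    rewrite upd_same. state_eq.
  - eapply ESeq; [now apply unpair_com_correct|].
    set (n := fst (of_nat (s d))). set (a := snd (of_nat (s d))).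
    assert (Hloop : forall n a,
      ceval (While d (com_of f (1 + d))) (upd (upd s d n) (S d) a)
        (upd (upd s d 0) (S d) (Nat.iter n (ev f) a))).
    { clear n a. induction n as [|n IH]; intro a.
      - apply EWhileO. upd_solve.
      - eapply EWhileS with (v := n); [upd_solve| |].
        + apply IHf. zeros Hs.
        + rewrite Nat.iter_succ_r. eapply ceval_eq; [|reflexivity].
          match goal with |- ceval _ ?s0 _ =>
            replace s0 with (upd (upd s d n) (S d) (ev f a)) end; [apply IH|].
          replace (upd (upd (upd s d (S n)) (S d) a) d n (1 + d)) with a
            by upd_solve.
          state_eq. }
    eapply ESeq; [apply Hloop|].
    eapply ceval_eq; [apply move_correct; lia | state_eq_with Hs d].
Qed.

Lemma exec_det p s : forall f f' pc r r',
  exec p f pc s = Some r -> exec p f' pc s = Some r' -> r = r'.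
Proof.
  intro f. revert s. induction f; intros s f' pc r r' H H'.
  - destruct f'; simpl in *; destruct (nth_error p pc); congruence.
  - destruct f'; simpl in *; destruct (nth_error p pc) as [[k|k j]|];
      try congruence; [eauto|].
    destruct (s k); eauto.
Qed.

Lemma exec_more p k : forall f pc s r,
  exec p f pc s = Some r -> exec p (f + k) pc s = Some r.
Proof.
  induction f; intros pc s r H.
  - simpl in H. destruct (nth_error p pc) eqn:E; [discriminate|].
    destruct k; simpl; now rewrite E.
  - simpl in *. destruct (nth_error p pc) as [[x|x j]|]; auto; destruct (s x); auto.
Qed.

Lemma runs_det q l r r' : runs q l r -> runs q l r' -> r = r'.
Proof. intros [f H] [f' H']. eapply exec_det; eauto. Qed.

Lemma reach_exec p s s' : reach p 0 s (length p) s' -> exists f, exec p f 0 s = Some s'.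
Proof. intros [k H]. exists (k + 0). rewrite H. now apply exec_end. Qed.

Lemma init_pair a b k : 1 < k -> init [a; b] k = 0.
Proof. intro H. destruct k as [|[|[|k]]]; try lia; reflexivity. Qed.

Definition pair_call (f : comb) : com := Seq (pair_com 0) (com_of f 0).

Lemma pair_call_correct f a b :
  ceval (pair_call f) (init [a; b]) (init [ev f (to_nat (a, b))]).
Proof.
  eapply ESeq; [apply pair_com_correct; apply init_pair|].
  eapply ceval_eq; [apply com_of_correct; intros k Hk|].
  - pose proof (init_pair a b k). upd_solve.
  - apply functional_extensionality; intros [|[|[|k]]]; reflexivity.
Qed.

(** The final unpairing leaves numerator and denominator in registers 0 and 1, the format that
    [LowerSemicomputable] expects. The zero register lies beyond both inputs. *)
Definition function_program (f : comb) : str :=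
  let c := Seq (pair_call f) (unpair_com 0) in
  encode (compile (2 + cbound c) 0 c).

Lemma function_program_runs f a b :
  exists r, runs (function_program f) [a; b] r /\
    r 0 = fst (of_nat (ev f (to_nat (a, b)))) /\
    r 1 = snd (of_nat (ev f (to_nat (a, b)))).
Proof.
  unfold function_program, runs. rewrite decode_encode.
  set (c := Seq _ _). set (z := 2 + cbound c). set (p := compile z 0 c).
  eassert (Hc : ceval c (init [a; b]) _).
  { eapply ESeq; [apply pair_call_correct|].
    apply unpair_com_correct. intros [|[|k]] Hk; [lia | reflexivity..]. }
  eexists. split; [apply reach_exec|].
  - replace (length p) with (0 + csize c) by (symmetry; apply compile_length).
    eapply (compile_correct _ _ _ Hc z); [lia | apply init_pair; lia|].
    exists [], []. now rewrite app_nil_r.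
  - unfold upd. simpl. auto.
Qed.

(** The final instruction loops when register 0 is 0. *)
Definition domain_program (f : comb) : str :=
  let c := pair_call f in
  encode (compile (2 + cbound c) 0 c ++ [DEC 0 (csize c)]).

Lemma domain_program_halts f a b :
  (exists r, runs (domain_program f) [a; b] r) <-> ev f (to_nat (a, b)) <> 0.
Proof.
  unfold domain_program, runs. rewrite decode_encode.
  set (c := pair_call f). set (z := 2 + cbound c). set (p := compile z 0 c).
  assert (Hc := pair_call_correct f a b). fold c in Hc.
  assert (Hr : reach (p ++ [DEC 0 (csize c)]) 0 (init [a; b]) (0 + csize c)
                 (init [ev f (to_nat (a, b))])).
  { eapply (compile_correct _ _ _ Hc z); [lia | apply init_pair; lia|].
    now exists [], [DEC 0 (csize c)]. }
  assert (Hi : nth_error (p ++ [DEC 0 (csize c)]) (csize c) = Some (DEC 0 (csize c))).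
  { rewrite nth_error_app2; unfold p; rewrite compile_length; auto.
    now rewrite Nat.sub_diag. }
  assert (Hp : length p = csize c) by apply compile_length.
  set (v := ev f (to_nat (a, b))) in *. clearbody p z c v.
  simpl in Hr. split.
  - intros (r & g & Hg) H0. destruct Hr as [k Hk].
    assert (Hloop : forall g, exec (p ++ [DEC 0 (csize c)]) g (csize c)
              (init [v]) = None).
    { induction g0; simpl; rewrite Hi; auto. now subst v. }
    (* The supposed halting run, given [k] more units of fuel, meets the loop that never returns. *)
    specialize (Hk g). rewrite Hloop, Nat.add_comm, (exec_more _ _ _ _ _ _ Hg) in Hk.
    discriminate.
  - intro Hn. destruct v as [|v]; [congruence|].
    eexists. apply reach_exec. eapply reach_trans; [exact Hr|].
    rewrite length_app. simpl. rewrite Hp, Nat.add_1_r.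
    eapply reach_dec_S; [exact Hi | reflexivity].
Qed.

(** * Codes of data types and closure properties of primitive recursion *)

Local Arguments to_nat : simpl never.
Local Arguments of_nat : simpl never.

(** The codes are chosen to make constructors and matches cheap: a number is its own code, [enc] is
    a bijection, so [enc] and [dec] cost nothing, and an option is zero or a successor. *)
Class Code (A : Type) := code : A -> nat.

#[export] Instance code_nat : Code nat := fun n => n.
#[export] Instance code_bool : Code bool := fun b => if b then 1 else 0.
#[export] Instance code_str : Code str := enc.
#[export] Instance code_prod A B `{Code A} `{Code B} : Code (A * B) :=
  fun p => to_nat (code (fst p), code (snd p)).
#[export] Instance code_option A `{Code A} : Code (option A) :=
  fun o => match o with None => 0 | Some a => S (code a) end.

Definition PR {A B} `{Code A} `{Code B} (f : A -> B) : Prop :=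
  exists e, forall a, ev e (code a) = code (f a).

Lemma code_pair A B `{Code A} `{Code B} (p : A * B) :
  code p = to_nat (code (fst p), code (snd p)).
Proof. reflexivity. Qed.

Section PrimitiveRecursive.
Context {A B X : Type} `{CA : Code A} `{CB : Code B} `{CX : Code X}.

Lemma PR_ext (f g : A -> B) : (forall a, f a = g a) -> PR f -> PR g.
Proof. intros H [e He]. exists e. intro a. now rewrite <- H. Qed.

Lemma PR_const (b : B) : PR (fun _ : A => b).
Proof.
  exists (nat_rect (fun _ => comb) Zero (fun _ => Comp Succ) (code b)).
  intro a. induction (code b); simpl; auto.
Qed.

Lemma PR_comp (g : B -> X) (f : A -> B) : PR g -> PR f -> PR (fun a => g (f a)).
Proof.
  intros [e He] [e' He']. exists (Comp e e'). intro a. simpl. now rewrite He'.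
Qed.

Lemma PR_pair (f : A -> B) (g : A -> X) : PR f -> PR g -> PR (fun a => (f a, g a)).
Proof.
  intros [e He] [e' He']. exists (Pair e e'). intro a. simpl ev.
  now rewrite He, He'.
Qed.

Lemma PR_fst (f : A -> B * X) : PR f -> PR (fun a => fst (f a)).
Proof.
  intros [e He]. exists (Comp Fst e). intro a. simpl ev. rewrite He.
  now rewrite code_pair, cancel_of_to.
Qed.

Lemma PR_snd (f : A -> B * X) : PR f -> PR (fun a => snd (f a)).
Proof.
  intros [e He]. exists (Comp Snd e). intro a. simpl ev. rewrite He.
  now rewrite code_pair, cancel_of_to.
Qed.

(** [Iter] takes no parameter, so the iterated state is a pair that carries [a] along unchanged. *)
Lemma PR_iter (n : A -> nat) (s : A -> B -> B) (b : A -> B) :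
  PR n -> PR (fun p : A * B => s (fst p) (snd p)) -> PR b ->
  PR (fun a => Nat.iter (n a) (s a) (b a)).
Proof.
  intros [en Hn] [es Hs] [eb Hb].
  exists (Comp Snd (Comp (Iter (Pair Fst es)) (Pair en (Pair Id eb)))).
  intro a. simpl ev. rewrite cancel_of_to. simpl fst. simpl snd.
  rewrite Hn, Hb. unfold code at 1, code_nat.
  enough (H : Nat.iter (n a) (ev (Pair Fst es)) (to_nat (code a, code (b a)))
            = to_nat (code a, code (Nat.iter (n a) (s a) (b a)))).
  { simpl ev in H. rewrite H. now rewrite cancel_of_to. }
  generalize (n a). induction n0; auto.
  rewrite !Nat.iter_succ, IHn0. simpl ev. rewrite cancel_of_to.
  f_equal. f_equal. apply (Hs (a, _)).
Qed.

Lemma PR_S (n : A -> nat) : PR n -> PR (fun a => S (n a)).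
Proof. intros [e He]. exists (Comp Succ e). intro a. simpl. now rewrite He. Qed.

End PrimitiveRecursive.

Lemma PR_id {A} `{Code A} : PR (fun a : A => a).
Proof. now exists Id. Qed.

Lemma PR_ev e : PR (ev e).
Proof. now exists e. Qed.

Ltac pr_step :=
  match goal with
  | |- PR (fun x => x) => apply PR_id
  | |- PR (fun _ => ?b) => apply (PR_const b)
  | |- PR (fun x => (_, _)) => apply PR_pair
  | |- PR (fun x => fst _) => apply PR_fst
  | |- PR (fun x => snd _) => apply PR_snd
  | |- PR (fun x => S _) => apply PR_S
  | |- PR (@fst _ _) => apply (PR_fst (fun p => p))
  | |- PR (@snd _ _) => apply (PR_snd (fun p => p))
  | |- PR S => apply (PR_S (fun n => n))
  | |- PR (fun x => Nat.iter _ _ _) => apply PR_iter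
  | H : PR ?f |- PR ?g => exact H
  end; cbv beta.
Ltac pr := repeat pr_step.

(** Recursion is reduced to iteration by storing the stage number in the state. *)
Lemma PR_nat_rect {A B} `{Code A} `{Code B} (n : A -> nat) (b : A -> B)
    (s : A -> nat -> B -> B) :
  PR n -> PR b -> PR (fun t : A * nat * B => s (fst (fst t)) (snd (fst t)) (snd t)) ->
  PR (fun a => nat_rect (fun _ => B) (b a) (s a) (n a)).
Proof.
  intros Hn Hb Hs.
  eapply PR_ext with (f := fun a =>
    snd (Nat.iter (n a) (fun p => (S (fst p), s a (fst p) (snd p))) (0, b a))).
  - intro a.
    enough (E : Nat.iter (n a) (fun p => (S (fst p), s a (fst p) (snd p))) (0, b a)
                = (n a, nat_rect (fun _ => B) (b a) (s a) (n a))) by now rewrite E.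
    generalize (n a). induction n0; auto. rewrite Nat.iter_succ. now rewrite IHn0.
  - pr. apply (PR_comp (fun t : A * nat * B => s (fst (fst t)) (snd (fst t)) (snd t))
        (fun x : A * (nat * B) => (fst x, fst (snd x), snd (snd x)))); auto. pr.
Qed.

Lemma PR_nat_match {A B} `{Code A} `{Code B} (n : A -> nat) (b : A -> B)
    (s : A -> nat -> B) :
  PR n -> PR b -> PR (fun t : A * nat => s (fst t) (snd t)) ->
  PR (fun a => match n a with 0 => b a | S m => s a m end).
Proof.
  intros Hn Hb Hs.
  eapply PR_ext with (f := fun a => nat_rect (fun _ => B) (b a) (fun i _ => s a i) (n a)).
  - intro a. now destruct (n a).
  - apply PR_nat_rect; auto.
    apply (PR_comp (fun t : A * nat => s (fst t) (snd t))
        (fun x : A * nat * B => fst x)); auto. pr.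
Qed.

Lemma PR_option_match {A X B} `{Code A} `{Code X} `{Code B} (o : A -> option X)
    (b : A -> B) (s : A -> X -> B) :
  PR o -> PR b -> PR (fun t : A * X => s (fst t) (snd t)) ->
  PR (fun a => match o a with None => b a | Some x => s a x end).
Proof.
  intros [eo Ho] [eb Hb] [es Hs].
  (* On codes, a match on an option is a zero test whose predecessor is the code of the content. *)
  assert (E : PR (fun c => match ev eo c with
                           | 0 => ev eb c | S m => ev es (to_nat (c, m)) end)).
  { apply PR_nat_match; try apply PR_ev. now exists es. }
  destruct E as [e He]. exists e. intro a. etransitivity; [exact (He (code a))|].
  unfold code at 1, code_nat. rewrite Ho.
  destruct (o a) as [x|]; [apply (Hs (a, x)) | apply Hb].
Qed.

Lemma PR_Some {A X} `{Code A} `{Code X} (f : A -> X) : PR f -> PR (fun a => Some (f a)).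
Proof. intros [e He]. exists (Comp Succ e). intro a. simpl. now rewrite He. Qed.

Lemma PR_if {A B} `{Code A} `{Code B} (c : A -> bool) (f g : A -> B) :
  PR c -> PR f -> PR g -> PR (fun a => if c a then f a else g a).
Proof.
  intros [ec Hc] Hf Hg.
  eapply PR_ext with (f := fun a => match ev ec (code a) with
                                    | 0 => g a | S _ => f a end).
  - intro a. rewrite Hc. now destruct (c a).
  - apply (PR_nat_match (fun a => ev ec (code a))); auto.
    + now exists ec.
    + apply (PR_comp f fst); auto. pr.
Qed.

Lemma PR_pred {A} `{Code A} (f : A -> nat) : PR f -> PR (fun a => Nat.pred (f a)).
Proof.
  intro Hf. eapply PR_ext; [|apply (PR_nat_match f (fun _ => 0) (fun _ m => m)); pr].
  intro a. cbv beta. now destruct (f a).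
Qed.

Lemma PR_add {A} `{Code A} (f g : A -> nat) : PR f -> PR g -> PR (fun a => f a + g a).
Proof.
  intros Hf Hg. eapply PR_ext with (f := fun a => Nat.iter (f a) S (g a)).
  - intro a. generalize (f a). induction n; auto.
    rewrite Nat.iter_succ. simpl. now rewrite IHn.
  - pr.
Qed.

Lemma PR_sub {A} `{Code A} (f g : A -> nat) : PR f -> PR g -> PR (fun a => f a - g a).
Proof.
  intros Hf Hg. eapply PR_ext with (f := fun a => Nat.iter (g a) Nat.pred (f a)).
  - intro a. generalize (g a). induction n; [simpl | rewrite Nat.iter_succ]; lia.
  - pr. apply (PR_pred snd). pr.
Qed.

Lemma PR_mul {A} `{Code A} (f g : A -> nat) : PR f -> PR g -> PR (fun a => f a * g a).
Proof.
  intros Hf Hg. eapply PR_ext with (f := fun a => Nat.iter (f a) (Nat.add (g a)) 0).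
  - intro a. generalize (f a). induction n; [simpl | rewrite Nat.iter_succ]; lia.
  - pr. apply PR_add; [|pr]. apply (PR_comp g fst); pr.
Qed.

Lemma PR_eqb {A} `{Code A} (f g : A -> nat) : PR f -> PR g -> PR (fun a => Nat.eqb (f a) (g a)).
Proof.
  intros Hf Hg. eapply PR_ext with (f := fun a =>
    match (f a - g a) + (g a - f a) with 0 => true | S _ => false end).
  - intro a. destruct (Nat.eqb_spec (f a) (g a)) as [->|Hn].
    + now rewrite Nat.sub_diag.
    + destruct (f a - g a + (g a - f a)) eqn:E; auto; lia.
  - apply (PR_nat_match (fun a => f a - g a + (g a - f a))); pr.
    apply PR_add; now apply PR_sub.
Qed.

Lemma PR_pow2 {A} `{Code A} (f : A -> nat) : PR f -> PR (fun a => 2 ^ f a).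
Proof.
  intros Hf. eapply PR_ext with (f := fun a => Nat.iter (f a) (fun m => m + m) 1).
  - intro a. generalize (f a). induction n; auto.
    rewrite Nat.iter_succ.    rewrite IHn. simpl. lia.
  - pr. apply PR_add; pr.
Qed.

Lemma PR_odd_div2 : PR (fun n => (Nat.odd n, Nat.div2 n)).
Proof.
  eapply PR_ext with (f := fun n : nat => Nat.iter n
    (fun p : bool * nat => if fst p then (false, S (snd p)) else (true, snd p)) (false, 0)).
  - intro n. induction n; auto.
    rewrite Nat.iter_succ, IHn. simpl fst. simpl snd.
    rewrite Nat.odd_succ, <- Nat.negb_odd.
    destruct (Nat.odd n) eqn:E; simpl negb; f_equal.
    + apply Nat.odd_spec in E as [m ->]. replace (S (2 * m + 1)) with (2 * S m) by lia.
      rewrite Nat.div2_double, Nat.add_1_r. now rewrite Nat.div2_succ_double.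
    + assert (Ev : Nat.even n = true) by now rewrite <- Nat.negb_odd, E.
      apply Nat.even_spec in Ev as [m ->].
      now rewrite Nat.div2_double, Nat.div2_succ_double.
  - pr. apply PR_if; pr.
Qed.

Fixpoint dec_aux (f n : nat) : str :=
  match f, n with
  | S f, S m => Nat.odd m :: dec_aux f (Nat.div2 m)
  | _, _ => []
  end.

Definition dec (n : nat) : str := dec_aux n n.

Lemma enc_dec n : enc (dec n) = n.
Proof.
  unfold dec. enough (H : forall f n, n <= f -> enc (dec_aux f n) = n) by now apply H.
  clear. induction f; intros [|m] Hm; simpl dec_aux; simpl enc; try lia.
  rewrite IHf.
  - pose proof (Nat.div2_odd m). destruct (Nat.odd m); simpl Nat.b2n in *; lia.
  - pose proof (Nat.div2_odd m). destruct (Nat.odd m); simpl Nat.b2n in *; lia.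
Qed.

Lemma enc_cons b y : enc (b :: y) = S (2 * enc y + Nat.b2n b).
Proof. now destruct b. Qed.

Lemma odd_div2_enc b y :
  (Nat.odd (2 * enc y + Nat.b2n b), Nat.div2 (2 * enc y + Nat.b2n b)) = (b, enc y).
Proof.
  rewrite Nat.odd_add, Nat.odd_mul. destruct b; cbn [Nat.b2n]; f_equal.
  - now rewrite Nat.add_1_r, Nat.div2_succ_double.
  - now rewrite Nat.add_0_r, Nat.div2_double.
Qed.

Lemma enc_inj x y : enc x = enc y -> x = y.
Proof.
  revert y. induction x as [|b x IH]; intros [|c y] H; auto; try discriminate.
  rewrite !enc_cons in H. injection H as H.
  assert (E := odd_div2_enc b x). assert (E' := odd_div2_enc c y).
  assert (H' : 2 * enc x + Nat.b2n b = 2 * enc y + Nat.b2n c) by lia.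
  rewrite H', E' in E. injection E as -> E. f_equal. now apply IH.
Qed.

Lemma dec_enc x : dec (enc x) = x.
Proof. apply enc_inj, enc_dec. Qed.

Lemma length_le_enc x : length x <= enc x.
Proof. induction x; auto. rewrite enc_cons. simpl length. lia. Qed.

Section Strings.
Context {A B : Type} `{CA : Code A} `{CB : Code B}.

Lemma PR_dec (f : A -> nat) : PR f -> PR (fun a => dec (f a)).
Proof.
  intros [e He]. exists e. intro a. rewrite He. symmetry. apply enc_dec.
Qed.

Lemma PR_enc (f : A -> str) : PR f -> PR (fun a => enc (f a)).
Proof. intros [e He]. now exists e. Qed.

Lemma PR_cons (b : A -> bool) (x : A -> str) : PR b -> PR x -> PR (fun a => b a :: x a : str).
Proof.
  intros Hb Hx.
  assert (H : PR (fun a => S (enc (x a) + enc (x a) + if b a then 1 else 0))).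
  { apply PR_S. apply PR_add; [apply PR_add; now apply PR_enc|]. apply PR_if; pr. }
  destruct H as [e He]. exists e. intro a. rewrite He. unfold code, code_nat, code_str.
  rewrite enc_cons. destruct (b a); simpl; lia.
Qed.

(** The predecessor of the code of [b :: y] is [2 * enc y + b]: its parity is the head and its half
    the code of the tail. *)
Lemma PR_str_match (x : A -> str) (n : A -> B) (c : A -> bool -> str -> B) :
  PR x -> PR n -> PR (fun t : A * (bool * str) => c (fst t) (fst (snd t)) (snd (snd t))) ->
  PR (fun a => match x a with [] => n a | b :: y => c a b y end).
Proof.
  intros [ex Hx] [en Hn] [ec Hc]. destruct PR_odd_div2 as [ed Hd].
  assert (E : PR (fun a => match ev ex a with
      | 0 => ev en a | S m => ev ec (to_nat (a, ev ed m)) end)).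
  { apply PR_nat_match; try apply PR_ev. exists (Comp ec (Pair Fst (Comp ed Snd))).
    intros [a m]. simpl ev. now rewrite code_pair, cancel_of_to. }
  destruct E as [e He]. exists e. intro a. etransitivity; [exact (He (code a))|].
  unfold code at 1, code_nat. rewrite Hx. unfold code at 1, code_str.
  destruct (x a) as [|b y]; [apply Hn|].
  rewrite enc_cons. etransitivity; [|apply (Hc (a, (b, y)))].
  do 2 f_equal. rewrite code_pair. do 2 f_equal. rewrite code_pair.
  etransitivity; [apply Hd|]. now rewrite odd_div2_enc.
Qed.

End Strings.

Lemma PR_fold {A B} `{Code A} `{Code B} (s : A -> B -> bool -> B) (x : A -> str)
    (b : A -> B) :
  PR (fun t : A * B * bool => s (fst (fst t)) (snd (fst t)) (snd t)) -> PR x -> PR b ->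
  PR (fun a => fold_left (s a) (x a) (b a)).
Proof.
  intros Hs Hx Hb.
  set (st := fun a (p : B * str) =>
         match snd p with [] => p | c :: y => (s a (fst p) c, y) end).
  (* The code of a string is at least its length, hence enough rounds; on [[]] the step is idle. *)
  eapply PR_ext with (f := fun a => fst (Nat.iter (enc (x a)) (st a) (b a, x a))).
  - intro a.
    enough (E : forall n y acc, length y <= n ->
        Nat.iter n (st a) (acc, y) = (fold_left (s a) y acc, []))
      by (rewrite E; auto; apply length_le_enc).
    induction n; intros y acc Hy.
    + destruct y; simpl in *; auto; lia.
    + rewrite Nat.iter_succ_r. destruct y as [|c y]; simpl in Hy.
      * apply (IHn [] acc). simpl. lia.
      * apply (IHn y (s a acc c)). lia.
  - pr. unfold st.
    apply (PR_str_match (fun p : A * (B * str) => snd (snd p)) (fun p => snd p)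
      (fun p c y => (s (fst p) (fst (snd p)) c, y))); pr.
    apply (PR_comp (fun t : A * B * bool => s (fst (fst t)) (snd (fst t)) (snd t))
      (fun x : A * (B * str) * (bool * str) =>
         (fst (fst x), fst (snd (fst x)), fst (snd x)))); auto. pr.
Qed.

Lemma PR_length {A} `{Code A} (x : A -> str) : PR x -> PR (fun a => length (x a)).
Proof.
  intro Hx. eapply PR_ext with (f := fun a => fold_left (fun n _ => S n) (x a) 0).
  - intro a. symmetry. rewrite <- Nat.add_0_l at 1. generalize 0.
    induction (x a); intro n; simpl; [lia|]. rewrite <- IHs. lia.
  - apply PR_fold; pr.
Qed.

Lemma PR_snoc {A} `{Code A} (x : A -> str) (b : A -> bool) :
  PR x -> PR b -> PR (fun a => x a ++ [b a] : str).
Proof.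
  intros Hx Hb.
  assert (Hrev : forall x : A -> str, PR x -> PR (fun a => rev (x a) : str)).
  { clear. intros x Hx.
    eapply PR_ext with (f := fun a => fold_left (fun (y : str) c => c :: y : str) (x a) []).
    - intro a. rewrite <- (app_nil_r (rev (x a))). generalize (@nil bool).
      induction (x a); intro l; simpl; auto. rewrite IHs, <- app_assoc. reflexivity.
    - apply (PR_fold (fun _ (y : str) c => c :: y : str)); pr. apply PR_cons; pr. }
  eapply PR_ext with (f := fun a => rev (b a :: rev (x a)) : str).
  - intro a. simpl. now rewrite rev_involutive.
  - apply Hrev, PR_cons; auto.
Qed.

(** * A step-bounded interpreter *)

Definition skip_true (p : nat * str) : nat * str :=
  match snd p with
  | [] => p
  | c :: t => if c then (S (fst p), t) else p
  end.

Definition leading_trues (t : str) : nat * str := Nat.iter (enc t) skip_true (0, t).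

(** [read_unary] recast as a plain iteration that strips leading ones, so that the closure lemmas
    apply. An empty remainder means that the terminating zero is missing. *)
Definition parse_unary (t : str) : option (nat * str) :=
  match snd (leading_trues t) with
  | [] => None
  | _ :: y => Some (fst (leading_trues t), y)
  end.

Lemma parse_unary_spec t : parse_unary t = read_unary (length t) t.
Proof.
  unfold parse_unary, leading_trues.
  enough (H : forall t k n f, length t <= n -> length t <= f ->
    match snd (Nat.iter n skip_true (k, t)) with
    | [] => None
    | _ :: y => Some (fst (Nat.iter n skip_true (k, t)), y)
    end = match read_unary f t with
          | None => None
          | Some p => Some (k + fst p, snd p)
          end).
  { etransitivity; [apply (H t 0 (enc t) (length t)); auto using length_le_enc|].
    destruct (read_unary (length t) t) as [[]|]; reflexivity. }
  clear. induction t as [|[|] t IH]; intros k n f Hn Hf; simpl in Hn, Hf.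
  - assert (E : Nat.iter n skip_true (k, []) = (k, [])).
    { clear. induction n; auto. now rewrite Nat.iter_succ, IHn. }
    rewrite E. now destruct f.
  - destruct n as [|n], f as [|f]; try lia. rewrite Nat.iter_succ_r.
    change (skip_true (k, true :: t)) with (S k, t).
    rewrite (IH (S k) n f) by lia. simpl.
    destruct (read_unary f t) as [[m y]|]; auto. simpl. now rewrite Nat.add_succ_r.
  - assert (E : Nat.iter n skip_true (k, false :: t) = (k, false :: t)).
    { clear. induction n; auto. now rewrite Nat.iter_succ, IHn. }
    rewrite E. destruct f; [lia|]. simpl. now rewrite Nat.add_0_r.
Qed.

Lemma read_unary_length f : forall t n y, read_unary f t = Some (n, y) -> length y < length t.
Proof.
  induction f; intros t n y H; [discriminate|].
  destruct t as [|[|] t]; simpl in *; try discriminate.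
  - destruct (read_unary f t) as [[m y']|] eqn:E; [|discriminate].
    injection H as <- <-. apply IHf in E. lia.
  - injection H as <- <-. lia.
Qed.

(** [(r, None)] stands for [INC r] and [(r, Some j)] for [DEC r j]. *)
Definition to_instr (i : nat * option nat) : instr :=
  match snd i with None => INC (fst i) | Some j => DEC (fst i) j end.

Definition parse_instr (s : str) : option ((nat * option nat) * str) :=
  match s with
  | [] => None
  | c :: t =>
      match parse_unary t with
      | None => None
      | Some p =>
          if c then
            match parse_unary (snd p) with
            | None => None
            | Some p' => Some ((fst p, Some (fst p')), snd p')
            end
          else Some ((fst p, None), snd p)
      end
  end.

Lemma parse_instr_length s i t : parse_instr s = Some (i, t) -> length t < length s.
Proof.
  destruct s as [|c s]; [discriminate|]. simpl. rewrite parse_unary_spec.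
  destruct (read_unary _ s) as [[r t']|] eqn:E; [|discriminate].
  apply read_unary_length in E. destruct c; simpl.
  - rewrite parse_unary_spec. destruct (read_unary _ t') as [[j t'']|] eqn:E'; [|discriminate].
    apply read_unary_length in E'. intros [= <- <-]. simpl. lia.
  - intros [= <- <-]. lia.
Qed.

Lemma decode_aux_parse f s :
  decode_aux (S f) s = match parse_instr s with
                       | None => []
                       | Some p => to_instr (fst p) :: decode_aux f (snd p)
                       end.
Proof.
  destruct s as [|[|] s]; simpl; auto; rewrite parse_unary_spec;
    destruct (read_unary _ s) as [[r t']|]; auto.
  simpl. rewrite parse_unary_spec. now destruct (read_unary _ t') as [[j t'']|].
Qed.

Definition skip_instr (s : str) : str :=
  match parse_instr s with None => [] | Some p => snd p end.

(** Each access parses the program text anew, which avoids coding lists of instructions. *)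
Definition fetch (s : str) (pc : nat) : option (nat * option nat) :=
  match parse_instr (Nat.iter pc skip_instr s) with
  | None => None
  | Some p => Some (fst p)
  end.

(** A failed parse sends [skip_instr] to [[]], where it stays; this agrees with a decoder that stops
    at the first incomplete instruction. *)
Lemma fetch_spec s pc : nth_error (decode s) pc = option_map to_instr (fetch s pc).
Proof.
  unfold decode. enough (H : forall pc s f, length s <= f ->
    nth_error (decode_aux f s) pc = option_map to_instr (fetch s pc)) by now apply H.
  clear. unfold fetch.
  assert (Hnil : forall pc, Nat.iter pc skip_instr [] = []).
  { induction pc; auto. now rewrite Nat.iter_succ, IHpc. }
  induction pc; intros s [|f] Hf.
  1,3: destruct s; simpl in Hf; [|lia]; rewrite Hnil; try reflexivity.
  - rewrite decode_aux_parse. simpl. now destruct (parse_instr s) as [[i t]|].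
  - rewrite decode_aux_parse, Nat.iter_succ_r. unfold skip_instr at 2.
    destruct (parse_instr s) as [[i t]|] eqn:E.
    + apply IHpc. apply parse_instr_length in E. simpl. lia.
    + now rewrite Hnil.
Qed.

(** A register file of finite support is a stream of nested pairs; since
    [of_nat 0 = (0, 0)], the code 0 is the all-zero file. *)
Definition tail (R : nat) : nat := snd (of_nat R).
Definition get (r R : nat) : nat := fst (of_nat (Nat.iter r tail R)).
(** Built from the inside out: the new cell in front of the old remainder, then registers [r - 1]
    down to 0 put in front. *)
Definition set_reg (r v R : nat) : nat :=
  nat_rect (fun _ => nat) (to_nat (v, Nat.iter (S r) tail R))
    (fun i acc => to_nat (get (r - S i) R, acc)) r.

Lemma get_cons k a R : get k (to_nat (a, R)) = match k with 0 => a | S k => get k R end.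
Proof.
  unfold get. destruct k.
  - simpl. now rewrite cancel_of_to.
  - rewrite Nat.iter_succ_r. unfold tail at 2. now rewrite cancel_of_to.
Qed.

Lemma get_tail k m R : get k (Nat.iter m tail R) = get (m + k) R.
Proof. unfold get. now rewrite Nat.add_comm, Nat.iter_add. Qed.

Lemma get_set r v R k : get k (set_reg r v R) = upd (fun k => get k R) r v k.
Proof.
  unfold set_reg, upd.
  enough (H : forall j k, j <= r -> get k (nat_rect (fun _ => nat)
      (to_nat (v, Nat.iter (S r) tail R))
      (fun i acc => to_nat (get (r - S i) R, acc)) j)
    = if Nat.eqb k j then v else get (r - j + k) R).
  { rewrite H by auto. now rewrite Nat.sub_diag. }
  clear k. induction j; intros k Hj; cbn [nat_rect]; rewrite get_cons.
  - destruct k; auto. rewrite get_tail. simpl. f_equal. lia.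
  - destruct k; simpl.
    + f_equal. lia.
    + rewrite IHj by lia. destruct (Nat.eqb k j); auto. f_equal. lia.
Qed.

Definition step (q : str) (st : nat * nat) : nat * nat :=
  match fetch q (fst st) with
  | None => st
  | Some i =>
      match snd i with
      | None => (S (fst st), set_reg (fst i) (S (get (fst i) (snd st))) (snd st))
      | Some j =>
          match get (fst i) (snd st) with
          | 0 => (j, snd st)
          | S v => (S (fst st), set_reg (fst i) v (snd st))
          end
      end
  end.

Definition simulate (q : str) (a n : nat) : nat * nat :=
  Nat.iter n (step q) (0, to_nat (a, 0)).

Definition run (q : str) (a n : nat) : option (nat * nat) :=
  match fetch q (fst (simulate q a n)) with
  | None => Some (get 0 (snd (simulate q a n)), get 1 (snd (simulate q a n)))
  | Some _ => None
  end.

(** A state without an instruction to fetch is a fixed point of [step], so halting within [n] steps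
    can be read off after exactly [n] of them. *)
Lemma run_spec q a n :
  run q a n = option_map (fun r => (r 0, r 1)) (exec (decode q) n 0 (init [a])).
Proof.
  unfold run, simulate.
  enough (H : forall n pc R s, (forall k, get k R = s k) ->
    match fetch q (fst (Nat.iter n (step q) (pc, R))) with
    | None => Some (get 0 (snd (Nat.iter n (step q) (pc, R))),
                    get 1 (snd (Nat.iter n (step q) (pc, R))))
    | Some _ => None
    end = option_map (fun r => (r 0, r 1)) (exec (decode q) n pc s)).
  { apply H. intros k. rewrite get_cons. destruct k; auto. unfold init.
    assert (E : forall j, Nat.iter j tail 0 = 0).
    { induction j; auto. now rewrite Nat.iter_succ, IHj. }
    unfold get. rewrite E. now destruct k. }
  clear. induction n; intros pc R s HR.
  - simpl. rewrite fetch_spec. destruct (fetch q pc); simpl; auto. now rewrite !HR.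
  - rewrite Nat.iter_succ_r. simpl exec. rewrite fetch_spec.
    destruct (fetch q pc) as [[r [j|]]|] eqn:E; simpl option_map; cbv beta iota.
    + replace (step q (pc, R)) with
        (match get r R with 0 => (j, R) | S v => (S pc, set_reg r v R) end)
        by (unfold step; simpl fst; now rewrite E).
      simpl to_instr. cbv iota. rewrite HR. destruct (s r); apply IHn; auto.
      intro k. rewrite get_set. unfold upd. now rewrite HR.
    + replace (step q (pc, R)) with (S pc, set_reg r (S (get r R)) R)
        by (unfold step; simpl fst; now rewrite E).
      apply IHn. intro k. rewrite get_set. unfold upd. now rewrite !HR.
    + assert (Es : Nat.iter n (step q) (step q (pc, R)) = (pc, R)).
      { rewrite <- Nat.iter_succ_r. clear - E. generalize (S n).
        induction n0; auto. rewrite Nat.iter_succ, IHn0. unfold step. simpl. now rewrite E. }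
      rewrite Es. simpl. rewrite E. now rewrite !HR.
Qed.

(** * The interpreter is primitive recursive *)

Lemma PR_to_nat {A} `{Code A} (f : A -> nat * nat) : PR f -> PR (fun a => to_nat (f a)).
Proof. intros [e He]. exists e. intro a. rewrite He. unfold code, code_prod, code_nat. now destruct (f a). Qed.

Lemma PR_of_nat {A} `{Code A} (f : A -> nat) : PR f -> PR (fun a => of_nat (f a)).
Proof.
  intros [e He]. exists e. intro a. rewrite He. symmetry. unfold code, code_prod, code_nat.
  rewrite <- (cancel_to_of (f a)) at 3. now destruct (of_nat (f a)).
Qed.

Lemma PR_comp2 {A B C X} `{Code A} `{Code B} `{Code C} `{Code X} (h : A -> B -> C)
    (f : X -> A) (g : X -> B) :
  PR (fun t : A * B => h (fst t) (snd t)) -> PR f -> PR g ->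
  PR (fun x => h (f x) (g x)).
Proof.
  intros Hh Hf Hg.
  apply (PR_comp (fun t : A * B => h (fst t) (snd t)) (fun x => (f x, g x))); auto.
  now apply PR_pair.
Qed.

Lemma PR_comp3 {A B C E X} `{Code A} `{Code B} `{Code C} `{Code E} `{Code X}
    (h : A -> B -> C -> E) (f : X -> A) (g : X -> B) (k : X -> C) :
  PR (fun t : A * B * C => h (fst (fst t)) (snd (fst t)) (snd t)) ->
  PR f -> PR g -> PR k -> PR (fun x => h (f x) (g x) (k x)).
Proof.
  intros Hh Hf Hg Hk.
  apply (PR_comp (fun t : A * B * C => h (fst (fst t)) (snd (fst t)) (snd t))
           (fun x => (f x, g x, k x))); auto.
  apply PR_pair; auto. now apply PR_pair.
Qed.

(** Hook of [pr_auto], redefined for each new layer of functions. *)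
Ltac pr_extra := fail.

Ltac pr_auto_step := first
  [ pr_step
  | match goal with
    | |- PR (fun a => match _ with None => _ | Some _ => _ end) => apply PR_option_match
    | |- PR (fun a => match _ with 0 => _ | S _ => _ end) => apply PR_nat_match
    | |- PR (fun a => match _ with [] => _ | _ :: _ => _ end) => apply PR_str_match
    | |- PR (fun a => if _ then _ else _) => apply PR_if
    | |- PR (fun a => Some _) => apply PR_Some
    | |- PR (fun a => _ + _) => apply PR_add
    | |- PR (fun a => 2 ^ _) => apply PR_pow2
    | H : PR ?h |- PR (fun a => ?h (@?x a)) => apply (PR_comp h x H)
    | |- PR (fun a => _ * _) => apply PR_mul
    | |- PR (fun a => _ - _) => apply PR_sub
    | |- PR (fun a => Nat.eqb _ _) => apply PR_eqb
    | |- PR (fun a => length _) => apply PR_length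
    | |- PR (fun a => dec _) => apply PR_dec
    | |- PR (fun a => enc _) => apply PR_enc
    | |- PR (fun a => to_nat _) => apply PR_to_nat
    | |- PR (fun a => of_nat _) => apply PR_of_nat
    | |- PR (fun a => _ ++ [_]) => apply PR_snoc
    | |- PR (fun a => fold_left _ _ _) => apply PR_fold
    | |- PR (fun a => nat_rect _ _ _ _) => apply PR_nat_rect
    end; cbv beta
  | pr_extra; cbv beta
  | match goal with |- PR ?f =>
      lazymatch f with
      | (fun _ => _) => fail
      | _ => change (PR (fun a => f a))
      end
    end ].
Ltac pr_auto := repeat pr_auto_step.

Lemma PR_leading_trues : PR leading_trues.
Proof. unfold leading_trues, skip_true. pr_auto. Qed.

Lemma PR_parse_unary : PR parse_unary.
Proof. unfold parse_unary. assert (H := PR_leading_trues). pr_auto. Qed.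

Ltac pr_extra ::= match goal with
  | |- PR (fun a => parse_unary _) => apply (PR_comp parse_unary _ PR_parse_unary)
  end.

Lemma PR_parse_instr : PR parse_instr.
Proof. unfold parse_instr. pr_auto. Qed.

Lemma PR_skip_instr : PR skip_instr.
Proof. unfold skip_instr. assert (H := PR_parse_instr). pr_auto. Qed.

Lemma PR_fetch : PR (fun t : str * nat => fetch (fst t) (snd t)).
Proof.
  unfold fetch. assert (H := PR_parse_instr). assert (H' := PR_skip_instr). pr_auto.
Qed.

Lemma PR_tail : PR tail.
Proof. unfold tail. pr_auto. Qed.

Lemma PR_get : PR (fun t : nat * nat => get (fst t) (snd t)).
Proof. unfold get. assert (H := PR_tail). pr_auto. Qed.

Lemma PR_set_reg :
  PR (fun t : nat * nat * nat => set_reg (fst (fst t)) (snd (fst t)) (snd t)).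
Proof.
  unfold set_reg. assert (H := PR_tail). assert (H' := PR_get). pr_auto.
  apply (PR_comp2 get); auto; pr_auto.
Qed.

Ltac pr_extra ::= match goal with
  | |- PR (fun a => fetch _ _) => apply (PR_comp2 fetch _ _ PR_fetch)
  | |- PR (fun a => get _ _) => apply (PR_comp2 get _ _ PR_get)
  | |- PR (fun a => set_reg _ _ _) => apply (PR_comp3 set_reg _ _ _ PR_set_reg)
  end.

Lemma PR_step : PR (fun t : str * (nat * nat) => step (fst t) (snd t)).
Proof. unfold step. pr_auto. Qed.

Lemma PR_simulate :
  PR (fun t : str * nat * nat => simulate (fst (fst t)) (snd (fst t)) (snd t)).
Proof. unfold simulate. assert (H := PR_step). pr_auto. apply (PR_comp2 step); auto; pr_auto. Qed.

Lemma PR_run : PR (fun t : str * nat * nat => run (fst (fst t)) (snd (fst t)) (snd t)).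
Proof. unfold run. assert (H := PR_simulate). pr_auto. Qed.

(** * The universal mixture *)

Definition val (n : nat) (q y : str) : option (nat * nat) :=
  match run q (enc y) n with
  | None => None
  | Some v => match snd v with 0 => None | S _ => Some v end
  end.

Definition consistent (v v0 v1 : nat * nat) : bool :=
  Nat.eqb ((fst v0 * snd v1 + fst v1 * snd v0) * snd v) (fst v * (snd v0 * snd v1)).

(** Numerator and denominator of [Q(yb) / Q(y)], once the computations of the
    program [q] of [Q] have halted and satisfy [Q(y0) + Q(y1) = Q(y) <> 0]. *)
Definition cond (n : nat) (q y : str) (b : bool) : option (nat * nat) :=
  match val n q y with
  | None => None
  | Some v =>
      match val n q (y ++ [false]) with
      | None => None
      | Some v0 =>
          match val n q (y ++ [true]) with
          | None => None
          | Some v1 =>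
              if consistent v v0 v1 then
                match fst v with
                | 0 => None
                | S _ => Some (fst (if b then v1 else v0) * snd v,
                               snd (if b then v1 else v0) * fst v)
                end
              else None
          end
      end
  end.

(** The stored fraction is multiplied by the mean of the two conditional probabilities, over a
    common denominator. [None] stands for any computation that has not finished or any check that
    fails, and it is absorbing. *)
Definition walk_step (n : nat) (q q' : str) (st : option (str * (nat * nat))) (b : bool) :=
  match st with
  | None => None
  | Some s =>
      match cond n q (fst s) b with
      | None => None
      | Some c =>
          match cond n q' (fst s) b with
          | None => None
          | Some c' =>
              Some (fst s ++ [b] : str,
                    (fst (snd s) * (fst c * snd c' + fst c' * snd c),
                     snd (snd s) * (2 * (snd c * snd c'))))
          end
      end
  end.

Definition walk (n : nat) (qq : str * str) (x : str) : option (str * (nat * nat)) :=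
  fold_left (walk_step n (fst qq) (snd qq)) x (Some ([] : str, (1, 1))).

Definition walk_of (U : str) (n : nat) (pp : str * str) (x : str) :
    option (str * (nat * nat)) :=
  match run U (enc (fst pp)) n with
  | None => None
  | Some u =>
      match run U (enc (snd pp)) n with
      | None => None
      | Some u' => walk n (dec (fst u), dec (fst u')) x
      end
  end.

Definition weight (pp : str * str) : nat :=
  if Nat.eqb (enc (fst pp)) (enc (snd pp)) then 2 ^ length (fst pp)
  else 2 ^ (length (fst pp) + length (snd pp)).

Definition term (U : str) (n : nat) (pp : str * str) (x : str) : nat * nat :=
  match walk_of U n pp x with
  | None => (0, 1)
  | Some v => (fst (snd v), snd (snd v) * weight pp)
  end.

Definition radd (u v : nat * nat) : nat * nat :=
  (fst u * snd v + fst v * snd u, snd u * snd v).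

Definition rsum (f : nat -> nat * nat) (n : nat) : nat * nat :=
  nat_rect (fun _ => (nat * nat)%type) (0, 1) (fun i acc => radd acc (f i)) n.

(** One [n] bounds the fuel and both program indices; the sum grows with each of these, which yields
    an increasing approximation. *)
Definition total (U : str) (n : nat) (x : str) : nat * nat :=
  rsum (fun i => rsum (fun j => term U n (dec i, dec j) x) n) n.

(** The total weight of all pairs of programs is at most 2. *)
Definition mix (U : str) (n : nat) (x : str) : nat * nat :=
  (fst (total U n x), 2 * snd (total U n x)).

Lemma PR_val : PR (fun t : nat * str * str => val (fst (fst t)) (snd (fst t)) (snd t)).
Proof. unfold val. assert (H := PR_run). pr_auto. apply (PR_comp3 run); auto; pr_auto. Qed.

Lemma PR_consistent :
  PR (fun t : (nat * nat) * (nat * nat) * (nat * nat) =>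
        consistent (fst (fst t)) (snd (fst t)) (snd t)).
Proof. unfold consistent. pr_auto. Qed.

Ltac pr_extra ::= match goal with
  | |- PR (fun a => run _ _ _) => apply (PR_comp3 run _ _ _ PR_run)
  | |- PR (fun a => val _ _ _) => apply (PR_comp3 val _ _ _ PR_val)
  | |- PR (fun a => consistent _ _ _) => apply (PR_comp3 consistent _ _ _ PR_consistent)
  end.

Lemma PR_cond :
  PR (fun t : nat * (str * str) * bool =>
        cond (fst (fst t)) (fst (snd (fst t))) (snd (snd (fst t))) (snd t)).
Proof. unfold cond. pr_auto. Qed.

Ltac pr_extra ::= match goal with
  | |- PR (fun a => run _ _ _) => apply (PR_comp3 run _ _ _ PR_run)
  | |- PR (fun a => cond (@?n a) (@?q a) (@?y a) (@?b a)) =>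
      apply (PR_comp _ (fun a => (n a, (q a, y a), b a)) PR_cond)
  end.

Lemma PR_walk :
  PR (fun t : nat * (str * str) * str => walk (fst (fst t)) (snd (fst t)) (snd t)).
Proof. unfold walk, walk_step. pr_auto. Qed.

Lemma PR_walk_of U :
  PR (fun t : nat * (str * str) * str => walk_of U (fst (fst t)) (snd (fst t)) (snd t)).
Proof. unfold walk_of. pr_auto. apply (PR_comp3 walk); [apply PR_walk | pr_auto ..]. Qed.

Lemma PR_term U :
  PR (fun t : nat * (str * str) * str => term U (fst (fst t)) (snd (fst t)) (snd t)).
Proof.
  unfold term, weight. assert (H := PR_walk_of U). pr_auto.
Qed.

Lemma PR_total U : PR (fun t : str * nat => total U (snd t) (fst t)).
Proof.
  unfold total, rsum, radd. pr_auto.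
  all: apply (PR_comp3 (term U)); [apply PR_term | pr_auto ..].
Qed.

Lemma PR_mix U : PR (fun t : str * nat => mix U (snd t) (fst t)).
Proof. unfold mix. assert (H := PR_total U). pr_auto. Qed.

(** * Stability under more fuel, and positive denominators *)

Lemma run_mono q a n m v : n <= m -> run q a n = Some v -> run q a m = Some v.
Proof.
  intro Hnm. rewrite !run_spec.
  destruct (exec (decode q) n 0 (init [a])) as [r|] eqn:E; [|discriminate].
  replace m with (n + (m - n)) by lia. now rewrite (exec_more _ _ _ _ _ _ E).
Qed.

Lemma run_runs q a r : runs q [a] r -> exists n, run q a n = Some (r 0, r 1).
Proof. intros [n H]. exists n. now rewrite run_spec, H. Qed.

Lemma run_halts q p n v : run q (enc p) n = Some v -> halts q p.
Proof.
  rewrite run_spec. destruct (exec _ _ _ _) as [r|] eqn:E; [|discriminate].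
  intros _. exists (dec (r 0)), r. split; [now exists n | now rewrite enc_dec].
Qed.

Lemma val_mono n m q y v : n <= m -> val n q y = Some v -> val m q y = Some v.
Proof.
  unfold val. intros Hnm. destruct (run q (enc y) n) eqn:E; [|discriminate].
  now rewrite (run_mono _ _ _ _ _ Hnm E).
Qed.

Lemma val_pos n q y v : val n q y = Some v -> 0 < snd v.
Proof.
  unfold val. destruct (run q (enc y) n) as [u|]; [|discriminate].
  destruct (snd u) eqn:E; [discriminate|]. intros [= <-]. lia.
Qed.

Lemma cond_mono n m q y b c : n <= m -> cond n q y b = Some c -> cond m q y b = Some c.
Proof.
  unfold cond. intros Hnm.
  destruct (val n q y) eqn:E; [|discriminate].
  destruct (val n q (y ++ [false])) eqn:E0; [|discriminate].
  destruct (val n q (y ++ [true])) eqn:E1; [|discriminate].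
  now rewrite (val_mono _ _ _ _ _ Hnm E), (val_mono _ _ _ _ _ Hnm E0),
    (val_mono _ _ _ _ _ Hnm E1).
Qed.

Lemma walk_snoc n qq x b :
  walk n qq (x ++ [b]) = walk_step n (fst qq) (snd qq) (walk n qq x) b.
Proof. unfold walk. now rewrite fold_left_app. Qed.

Lemma walk_mono n m qq x v : n <= m -> walk n qq x = Some v -> walk m qq x = Some v.
Proof.
  intro Hnm. revert v. induction x as [|b x IH] using rev_ind; auto.
  intro v. rewrite !walk_snoc. unfold walk_step.
  destruct (walk n qq x) as [s|]; [|discriminate]. rewrite (IH s eq_refl).
  destruct (cond n (fst qq) (fst s) b) eqn:E; [|discriminate].
  destruct (cond n (snd qq) (fst s) b) eqn:E'; [|discriminate].
  now rewrite (cond_mono _ _ _ _ _ _ Hnm E), (cond_mono _ _ _ _ _ _ Hnm E').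
Qed.

Lemma walk_of_mono U n m pp x v :
  n <= m -> walk_of U n pp x = Some v -> walk_of U m pp x = Some v.
Proof.
  unfold walk_of. intro Hnm.
  destruct (run U (enc (fst pp)) n) eqn:E; [|discriminate].
  destruct (run U (enc (snd pp)) n) eqn:E'; [|discriminate].
  rewrite (run_mono _ _ _ _ _ Hnm E), (run_mono _ _ _ _ _ Hnm E').
  now apply walk_mono.
Qed.

Lemma cond_pos n q y b c : cond n q y b = Some c -> 0 < snd c.
Proof.
  unfold cond.
  destruct (val n q y) as [v|] eqn:E; [|discriminate].
  destruct (val n q (y ++ [false])) as [v0|] eqn:E0; [|discriminate].
  destruct (val n q (y ++ [true])) as [v1|] eqn:E1; [|discriminate].
  apply val_pos in E0, E1.
  destruct (consistent v v0 v1); [|discriminate].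
  destruct (fst v); [discriminate|]. intros [= <-]. destruct b; simpl; lia.
Qed.

Lemma walk_inv n qq x s : walk n qq x = Some s -> fst s = x /\ 0 < snd (snd s).
Proof.
  revert s. induction x as [|b x IH] using rev_ind; intro s.
  - intros [= <-]. simpl. auto.
  - rewrite walk_snoc. unfold walk_step.
    destruct (walk n qq x) as [t|]; [|discriminate].
    destruct (IH t eq_refl) as [<- Ht].
    destruct (cond n (fst qq) (fst t) b) as [c|] eqn:E; [|discriminate].
    destruct (cond n (snd qq) (fst t) b) as [c'|] eqn:E'; [|discriminate].
    apply cond_pos in E, E'. intros [= <-]. simpl. split; auto.
    apply Nat.mul_pos_pos; auto. nia.
Qed.

Lemma weight_pos pp : 0 < weight pp.
Proof. unfold weight. destruct (Nat.eqb _ _); apply Nat.neq_0_lt_0, Nat.pow_nonzero; lia. Qed.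

Lemma walk_of_inv U n pp x s : walk_of U n pp x = Some s -> fst s = x /\ 0 < snd (snd s).
Proof.
  unfold walk_of. destruct (run _ _ _); [|discriminate].
  destruct (run _ _ _); [|discriminate]. apply walk_inv.
Qed.

Lemma term_pos U n pp x : 0 < snd (term U n pp x).
Proof.
  unfold term. destruct (walk_of U n pp x) as [s|] eqn:E; simpl; auto.
  apply walk_of_inv in E. pose proof (weight_pos pp). nia.
Qed.

Lemma rsum_pos f n : (forall i, 0 < snd (f i)) -> 0 < snd (rsum f n).
Proof.
  intro H. unfold rsum. induction n; simpl; auto. specialize (H n). nia.
Qed.

Lemma mix_pos U n x : 0 < snd (mix U n x).
Proof.
  unfold mix, total. simpl.
  enough (0 < snd (rsum (fun i => rsum (fun j => term U n (dec i, dec j) x) n) n)) by lia.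
  apply rsum_pos. intro. apply rsum_pos. intro. apply term_pos.
Qed.

(** * Finite sums and real values of the approximations *)

Open Scope R_scope.

Definition rv (u : nat * nat) : R := INR (fst u) / INR (snd u).

Definition fsum (f : nat -> R) (n : nat) : R :=
  nat_rect (fun _ => R) 0 (fun i acc => acc + f i) n.

Lemma fsum_S f n : fsum f (S n) = fsum f n + f n.
Proof. reflexivity. Qed.

Lemma fsum_le f g n : (forall i, (i < n)%nat -> f i <= g i) -> fsum f n <= fsum g n.
Proof.
  induction n; intro H; [apply Rle_refl|]. rewrite !fsum_S.
  apply Rplus_le_compat; auto.
Qed.

Lemma fsum_ext f g n : (forall i, (i < n)%nat -> f i = g i) -> fsum f n = fsum g n.
Proof.
  induction n; intro H; [reflexivity|]. rewrite !fsum_S, IHn, H; auto.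
Qed.

Lemma fsum_plus f g n : fsum (fun i => f i + g i) n = fsum f n + fsum g n.
Proof. induction n; [simpl; lra|]. rewrite !fsum_S, IHn. lra. Qed.

Lemma fsum_scal a f n : fsum (fun i => a * f i) n = a * fsum f n.
Proof. induction n; [simpl; lra|]. rewrite !fsum_S, IHn. lra. Qed.

Lemma fsum_const a n : fsum (fun _ => a) n = INR n * a.
Proof. induction n; [simpl; lra|]. rewrite fsum_S, IHn, S_INR. lra. Qed.

Lemma fsum_nonneg f n : (forall i, 0 <= f i) -> 0 <= fsum f n.
Proof. intro H. induction n; [apply Rle_refl|]. rewrite fsum_S. specialize (H n). lra. Qed.

Lemma fsum_mono f n m : (forall i, 0 <= f i) -> (n <= m)%nat -> fsum f n <= fsum f m.
Proof.
  intros H. induction 1; [apply Rle_refl|]. rewrite fsum_S. specialize (H m). lra.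
Qed.

Lemma fsum_ge_term f n i : (forall i, 0 <= f i) -> (i < n)%nat -> f i <= fsum f n.
Proof.
  intros H Hi. apply Rle_trans with (fsum f (S i)).
  - rewrite fsum_S. pose proof (fsum_nonneg f i H). lra.
  - now apply fsum_mono.
Qed.

Lemma fsum_exchange f n m :
  fsum (fun i => fsum (f i) m) n = fsum (fun j => fsum (fun i => f i j) n) m.
Proof.
  induction n.
  - simpl. induction m; [reflexivity|]. rewrite fsum_S, <- IHm. simpl. lra.
  - rewrite fsum_S, IHn, <- fsum_plus. now apply fsum_ext.
Qed.

Lemma fsum_single a i n :
  (i < n)%nat -> fsum (fun j => if Nat.eqb i j then a else 0) n = a.
Proof.
  intro Hi.
  enough (H : forall m, fsum (fun j => if Nat.eqb i j then a else 0) m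
            = if Nat.ltb i m then a else 0).
  { rewrite H. now rewrite (proj2 (Nat.ltb_lt i n) Hi). }
  induction m; [reflexivity|]. rewrite fsum_S, IHm.
  destruct (Nat.eqb_spec i m), (Nat.ltb_spec i m), (Nat.ltb_spec i (S m)); try lia; lra.
Qed.

(** Read as string codes, 0 is the empty string, while [S (2 * j)] and [S (S (2 * j))] put [false]
    and [true] in front of string number [j]. *)
Lemma fsum_odd_even f n :
  fsum f (S (2 * n)) = f 0%nat + fsum (fun j => f (S (2 * j)) + f (S (S (2 * j)))) n.
Proof.
  induction n; [simpl; lra|].
  replace (S (2 * S n)) with (S (S (S (2 * n)))) by lia.
  rewrite !(fsum_S _ (S _)), IHn, fsum_S. lra.
Qed.

Lemma rv_nonneg u : 0 <= rv u.
Proof.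
  unfold rv. destruct (snd u) eqn:E.
  - simpl. unfold Rdiv. rewrite Rinv_0. lra.
  - apply Rmult_le_pos; [apply pos_INR|]. left. apply Rinv_0_lt_compat.
    apply lt_0_INR. lia.
Qed.

Lemma rv_radd u v :
  (0 < snd u)%nat -> (0 < snd v)%nat -> rv (radd u v) = rv u + rv v.
Proof.
  intros Hu Hv. apply lt_0_INR in Hu, Hv. unfold rv, radd. simpl.
  rewrite plus_INR, !mult_INR. field. lra.
Qed.

Lemma rv_rsum f n :
  (forall i, (0 < snd (f i))%nat) -> rv (rsum f n) = fsum (fun i => rv (f i)) n.
Proof.
  intro H. induction n.
  - unfold rv. simpl. lra.
  - rewrite fsum_S, <- IHn. apply rv_radd; auto. now apply rsum_pos.
Qed.

Lemma rv_mix U n x :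
  rv (mix U n x)
  = / 2 * fsum (fun i => fsum (fun j => rv (term U n (dec i, dec j) x)) n) n.
Proof.
  assert (E : rv (total U n x)
    = fsum (fun i => fsum (fun j => rv (term U n (dec i, dec j) x)) n) n).
  { unfold total. rewrite rv_rsum.
    - apply fsum_ext. intros i _. apply rv_rsum. intro. apply term_pos.
    - intro. apply rsum_pos. intro. apply term_pos. }
  rewrite <- E. unfold rv, mix. cbn [fst snd]. rewrite mult_INR.
  replace (INR 2) with 2 by reflexivity. unfold Rdiv. rewrite Rinv_mult. lra.
Qed.

Lemma rv_term U n pp x :
  rv (term U n pp x) = match walk_of U n pp x with
                       | None => 0
                       | Some s => rv (snd s) / INR (weight pp)
                       end.
Proof.
  unfold term. destruct (walk_of U n pp x) as [s|]; unfold rv; simpl.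
  - rewrite mult_INR. unfold Rdiv. rewrite Rinv_mult. lra.
  - lra.
Qed.

Lemma inv_weight_pos pp : 0 < / INR (weight pp).
Proof. apply Rinv_0_lt_compat, lt_0_INR, weight_pos. Qed.

Lemma term_mono U n m pp x : (n <= m)%nat -> rv (term U n pp x) <= rv (term U m pp x).
Proof.
  intro Hnm. rewrite (rv_term U n). destruct (walk_of U n pp x) eqn:E.
  - rewrite rv_term, (walk_of_mono _ _ _ _ _ _ Hnm E). apply Rle_refl.
  - apply rv_nonneg.
Qed.

Lemma mix_mono U n m x : (n <= m)%nat -> rv (mix U n x) <= rv (mix U m x).
Proof.
  intro Hnm. rewrite !rv_mix. apply Rmult_le_compat_l; [lra|].
  eapply Rle_trans; [apply fsum_le|apply fsum_mono; [|exact Hnm]].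
  - intros i _. eapply Rle_trans; [apply fsum_le|apply fsum_mono; [|exact Hnm]].
    + intros j _. now apply term_mono.
    + intro. apply rv_nonneg.
  - intro. apply fsum_nonneg. intro. apply rv_nonneg.
Qed.

(** No test in [cond] depends on [b], so both children are defined as soon as one is, and the
    additivity check makes the two fractions add up to 1. *)
Lemma cond_both n q y b c :
  cond n q y b = Some c -> exists c0 c1,
    cond n q y false = Some c0 /\ cond n q y true = Some c1 /\ rv c0 + rv c1 = 1.
Proof.
  unfold cond.
  destruct (val n q y) as [v|] eqn:E; [|discriminate].
  destruct (val n q (y ++ [false])) as [v0|] eqn:E0; [|discriminate].
  destruct (val n q (y ++ [true])) as [v1|] eqn:E1; [|discriminate].
  destruct (consistent v v0 v1) eqn:Ec; [|discriminate].
  destruct (fst v) as [|k] eqn:Ev; [discriminate|]. intros _.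
  do 2 eexists. split; [reflexivity|]. split; [reflexivity|].
  apply val_pos in E, E0, E1. apply lt_0_INR in E, E0, E1.
  apply Nat.eqb_eq in Ec. rewrite Ev in Ec. apply (f_equal INR) in Ec.
  repeat rewrite ?mult_INR, ?plus_INR in Ec.
  assert (Hk : 0 < INR (S k)) by (apply lt_0_INR; lia).
  unfold rv. cbn [fst snd]. rewrite !mult_INR.
  apply (Rmult_eq_reg_r (INR (snd v0) * INR (snd v1) * INR (S k))).
  2: { apply Rgt_not_eq. repeat apply Rmult_lt_0_compat; auto. }
  field_simplify; [|lra]. nra.
Qed.

Lemma walk_step_value n qq x s b t :
  walk n qq x = Some s -> walk n qq (x ++ [b]) = Some t ->
  exists c c', cond n (fst qq) x b = Some c /\ cond n (snd qq) x b = Some c' /\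
    rv (snd t) = rv (snd s) * ((rv c + rv c') / 2).
Proof.
  intros Hs Ht. rewrite walk_snoc, Hs in Ht. apply walk_inv in Hs as [Hx Hs].
  unfold walk_step in Ht. rewrite Hx in Ht.
  destruct (cond n (fst qq) x b) as [c|] eqn:E; [|discriminate].
  destruct (cond n (snd qq) x b) as [c'|] eqn:E'; [|discriminate].
  exists c, c'. do 2 (split; [reflexivity|]). injection Ht as <-.
  apply cond_pos in E, E'. apply lt_0_INR in E, E', Hs.
  unfold rv. cbn [fst snd]. repeat rewrite ?mult_INR, ?plus_INR.
  simpl (INR 0).
  replace (INR (snd c) * INR (snd c') + (INR (snd c) * INR (snd c') + 0))
    with (2 * (INR (snd c) * INR (snd c'))) by ring.
  field. lra.
Qed.

Lemma walk_defined_snoc n qq x b t :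
  walk n qq (x ++ [b]) = Some t -> exists s, walk n qq x = Some s.
Proof.
  rewrite walk_snoc. destruct (walk n qq x) as [s|]; [now exists s | discriminate].
Qed.

(** Either both children are defined, and their values add up to that of the parent, or neither is,
    and the left side is 0. The programs need not compute measures. *)
Lemma term_superadditive U n pp x :
  rv (term U n pp (x ++ [false])) + rv (term U n pp (x ++ [true])) <= rv (term U n pp x).
Proof.
  rewrite !rv_term. unfold walk_of.
  destruct (run U (enc (fst pp)) n) as [u|]; [|lra].
  destruct (run U (enc (snd pp)) n) as [u'|]; [|lra].
  set (qq := (dec (fst u), dec (fst u'))). pose proof (inv_weight_pos pp) as Hw.
  assert (Hsome : forall b t, walk n qq (x ++ [b]) = Some t ->
    exists s t0 t1, walk n qq x = Some s /\ walk n qq (x ++ [false]) = Some t0 /\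
      walk n qq (x ++ [true]) = Some t1 /\ rv (snd t0) + rv (snd t1) = rv (snd s)).
  { intros b t Ht. destruct (walk_defined_snoc _ _ _ _ _ Ht) as [s Hs].
    destruct (walk_step_value _ _ _ _ _ _ Hs Ht) as (c & c' & Hc & Hc' & _).
    apply cond_both in Hc as (c0 & c1 & H0 & H1 & Hc).
    apply cond_both in Hc' as (c0' & c1' & H0' & H1' & Hc').
    assert (Hx := proj1 (walk_inv _ _ _ _ Hs)).
    assert (Hex : forall b, exists t, walk n qq (x ++ [b]) = Some t).
    { intros b'. rewrite walk_snoc, Hs. unfold walk_step. rewrite Hx.
      destruct b'; [rewrite H1, H1' | rewrite H0, H0']; eauto. }
    destruct (Hex false) as [t0 Ht0], (Hex true) as [t1 Ht1].
    exists s, t0, t1. do 3 (split; [assumption|]).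
    destruct (walk_step_value _ _ _ _ _ _ Hs Ht0) as (? & ? & E1 & E2 & ->).
    destruct (walk_step_value _ _ _ _ _ _ Hs Ht1) as (? & ? & E3 & E4 & ->).
    rewrite H0 in E1. rewrite H0' in E2. rewrite H1 in E3. rewrite H1' in E4.
    injection E1 as <-. injection E2 as <-. injection E3 as <-. injection E4 as <-.
    nra. }
  destruct (walk n qq (x ++ [false])) as [t|] eqn:E;
    [|destruct (walk n qq (x ++ [true])) as [t|] eqn:E'].
  - destruct (Hsome _ _ E) as (s & t0 & t1 & -> & E0 & -> & H).
    injection E0 as <-. unfold Rdiv. rewrite <- H. lra.
  - destruct (Hsome _ _ E') as (s & t0 & t1 & _ & E0 & _). congruence.
  - destruct (walk n qq x); [|lra].
    pose proof (rv_nonneg (snd p)). unfold Rdiv. nra.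
Qed.

Lemma mix_superadditive U n x :
  rv (mix U n (x ++ [false])) + rv (mix U n (x ++ [true])) <= rv (mix U n x).
Proof.
  rewrite !rv_mix, <- Rmult_plus_distr_l. apply Rmult_le_compat_l; [lra|].
  rewrite <- fsum_plus. apply fsum_le. intros i _.
  rewrite <- fsum_plus. apply fsum_le. intros j _. apply term_superadditive.
Qed.

(** * Kraft's inequality and the mixture as a semimeasure *)

Lemma kraft (h : str -> bool) n :
  (forall x y, h x = true -> h y = true -> is_prefix x y -> x = y) ->
  fsum (fun i => if h (dec i) then / 2 ^ length (dec i) else 0) n <= 1.
Proof.
  set (g := fun (h : str -> bool) i =>
              if h (dec i) then / 2 ^ length (dec i) else 0).
  assert (Hg : forall h i, 0 <= g h i).
  { intros h' i. unfold g. destruct (h' (dec i)); [|lra].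
    left. apply Rinv_0_lt_compat, pow_lt. lra. }
  intro Hh. fold (g h).
  (* Bounding arbitrarily long partial sums suffices, as the terms are nonnegative. This leaves the
     cut free to have the form [S (2 * k)], at which the sum splits into the root and the two
     subtrees, each halved. *)
  enough (H : forall m h,
    (forall x y, h x = true -> h y = true -> is_prefix x y -> x = y) ->
    exists k, (m <= k)%nat /\ fsum (g h) k <= 1).
  { destruct (H n h Hh) as (k & Hk & Hs).
    eapply Rle_trans; [now apply fsum_mono, Hk | exact Hs]. }
  clear h n Hh. induction m; intros h Hh.
  - exists 0%nat. simpl. split; [auto | lra].
  - assert (Hcons : forall b,
      (forall x y, h (b :: x) = true -> h (b :: y) = true -> is_prefix x y -> x = y)).
    { intros b x y Hx Hy [z ->]. assert (E : b :: x = b :: x ++ z)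
        by (apply Hh; auto; now exists z). congruence. }
    destruct (IHm (fun x => h (false :: x)) (Hcons false)) as (k0 & Hk0 & H0).
    destruct (IHm (fun x => h (true :: x)) (Hcons true)) as (k1 & Hk1 & H1).
    set (k := Nat.min k0 k1).
    assert (H0' : fsum (g (fun x => h (false :: x))) k <= 1)
      by (eapply Rle_trans; [apply fsum_mono; [apply Hg | apply Nat.le_min_l]|]; auto).
    assert (H1' : fsum (g (fun x => h (true :: x))) k <= 1)
      by (eapply Rle_trans; [apply fsum_mono; [apply Hg | apply Nat.le_min_r]|]; auto).
    exists (S (2 * k)). split; [unfold k; lia|].
    rewrite fsum_odd_even.
    assert (E : fsum (fun j => g h (S (2 * j)) + g h (S (S (2 * j)))) k
      = / 2 * (fsum (g (fun x => h (false :: x))) k + fsum (g (fun x => h (true :: x))) k)).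
    { rewrite <- fsum_plus, <- fsum_scal. apply fsum_ext. intros j _.
      assert (E0 : dec (S (2 * j)) = false :: dec j).
      { apply enc_inj. rewrite enc_cons, !enc_dec. simpl. lia. }
      assert (E1 : dec (S (S (2 * j))) = true :: dec j).
      { apply enc_inj. rewrite enc_cons, !enc_dec. simpl. lia. }
      unfold g. rewrite E0, E1. simpl length. rewrite <- tech_pow_Rmult, Rinv_mult.
      destruct (h (false :: dec j)), (h (true :: dec j)); lra. }
    rewrite E. unfold g at 1. change (dec 0) with (@nil bool).
    destruct (h []) eqn:Eh; simpl length; simpl pow; [|lra].
    (* If the root belongs to the set, prefix-freeness empties both subtrees. *)
    assert (Z : forall b, fsum (g (fun x => h (b :: x))) k = 0).
    { intro b. transitivity (fsum (fun _ => 0) k).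
      - apply fsum_ext. intros j _. unfold g.
        destruct (h (b :: dec j)) eqn:Eb; auto.
        assert (X : [] = b :: dec j) by (apply Hh; auto; now exists (b :: dec j)).
        discriminate.
      - rewrite fsum_const. lra. }
    rewrite !Z. lra.
Qed.

(** Separates the diagonal from a product: with s the Kraft sum, the total weight is at most s +
    s^2, hence at most 2. *)
Lemma inv_weight_le i j :
  / INR (weight (dec i, dec j))
  <= (if Nat.eqb i j then / 2 ^ length (dec i) else 0)
     + / 2 ^ length (dec i) * / 2 ^ length (dec j).
Proof.
  assert (Hp : forall k, 0 < / 2 ^ k) by (intro; apply Rinv_0_lt_compat, pow_lt; lra).
  pose proof (Rmult_lt_0_compat _ _ (Hp (length (dec i))) (Hp (length (dec j)))).
  unfold weight. cbn [fst snd]. rewrite !enc_dec.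
  destruct (Nat.eqb_spec i j); rewrite pow_INR; replace (INR 2) with 2 by reflexivity.
  - lra.
  - rewrite pow_add, Rinv_mult. lra.
Qed.

Lemma mix_nil U n : PrefixFree U -> rv (mix U n []) <= 1.
Proof.
  intro HU. rewrite rv_mix.
  (* The programs seen to halt within [n] steps lie in the prefix-free domain of [U]. *)
  set (h := fun p => match run U (enc p) n with None => false | Some _ => true end).
  set (g := fun i => if h (dec i) then / 2 ^ length (dec i) else 0).
  assert (Hk : fsum g n <= 1).
  { apply kraft. intros x y Hx Hy. apply HU; unfold h in Hx, Hy.
    - destruct (run U (enc x) n) eqn:E; [|discriminate]. eapply run_halts; eauto.
    - destruct (run U (enc y) n) eqn:E; [|discriminate]. eapply run_halts; eauto. }
  assert (Hg : forall i, 0 <= g i).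
  { intros i. unfold g. destruct (h (dec i)); [|lra].
    left. apply Rinv_0_lt_compat, pow_lt. lra. }
  assert (Hg0 := fsum_nonneg g n Hg).
  enough (fsum (fun i => fsum (fun j => rv (term U n (dec i, dec j) [])) n) n
          <= fsum (fun i => g i + g i * fsum g n) n) as H.
  { rewrite fsum_plus in H.
    replace (fsum (fun i => g i * fsum g n) n) with (fsum g n * fsum g n) in H.
    - nra.
    - rewrite <- fsum_scal. apply fsum_ext. intros. lra. }
  apply fsum_le. intros i Hi. rewrite <- fsum_scal.
  (* The diagonal part [g i] is spread over [j] as an indicator, so that the comparison is
     termwise. *)
  rewrite <- (fsum_single (g i) i n Hi) at 1. rewrite <- fsum_plus.
  apply fsum_le. intros j Hj. rewrite rv_term. unfold walk_of, g, h. cbn [fst snd].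
  assert (Hp : forall k, 0 < / 2 ^ k) by (intro; apply Rinv_0_lt_compat, pow_lt; lra).
  destruct (run U (enc (dec i)) n); [|destruct (Nat.eqb i j); lra].
  destruct (run U (enc (dec j)) n).
  - unfold walk. simpl fold_left. cbv iota. unfold rv. cbn [fst snd].
    pose proof (inv_weight_le i j). simpl INR. unfold Rdiv. lra.
  - pose proof (Hp (length (dec i))). destruct (Nat.eqb i j); lra.
Qed.

Definition is_mixture (U : str) (S : str -> R) : Prop :=
  forall x, is_lub (fun r => exists n, r = rv (mix U n x)) (S x).

Lemma mixture_exists U : PrefixFree U -> exists S, is_mixture U S.
Proof.
  intro HU.
  assert (Hb : forall n x, rv (mix U n x) <= 1).
  { intros n x. induction x as [|b x IH] using rev_ind; [now apply mix_nil|].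
    pose proof (mix_superadditive U n x). pose proof (rv_nonneg (mix U n (x ++ [false]))).
    pose proof (rv_nonneg (mix U n (x ++ [true]))). destruct b; lra. }
  assert (H : forall x, {l | is_lub (fun r => exists n, r = rv (mix U n x)) l}).
  { intro x. apply completeness.
    - exists 1. intros r [n ->]. apply Hb.
    - exists (rv (mix U 0 x)). now exists 0%nat. }
  exists (fun x => proj1_sig (H x)). intro x. apply proj2_sig.
Qed.

Lemma mixture_semimeasure U S : PrefixFree U -> is_mixture U S -> Semimeasure S.
Proof.
  intros HU HS. split; [|split].
  - intro x. destruct (HS x) as [Hub _].
    eapply Rle_trans; [apply (rv_nonneg (mix U 0 x)) | apply Hub; now exists 0%nat].
  - apply (HS []). intros r [n ->]. now apply mix_nil.
  - intro x. destruct (HS x) as [Hub _].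
    (* Stages [n] and [m] are raised to a common one; with independent stages the two suprema can be
       taken one after the other. *)
    assert (H : forall n m, rv (mix U n (x ++ [false])) + rv (mix U m (x ++ [true])) <= S x).
    { intros n m. set (k := Nat.max n m).
      pose proof (mix_mono U n k (x ++ [false]) (Nat.le_max_l n m)).
      pose proof (mix_mono U m k (x ++ [true]) (Nat.le_max_r n m)).
      pose proof (mix_superadditive U k x).
      assert (rv (mix U k x) <= S x) by (apply Hub; now exists k). lra. }
    assert (S (x ++ [false]) <= S x - S (x ++ [true])); [|lra].
    apply (HS (x ++ [false])). intros r [n ->].
    enough (S (x ++ [true]) <= S x - rv (mix U n (x ++ [false]))) by lra.
    apply (HS (x ++ [true])). intros r [m ->]. specialize (H n m). lra.
Qed.

Lemma mixture_lower_semicomputable U S : is_mixture U S -> LowerSemicomputable S.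
Proof.
  intro HS. destruct (PR_mix U) as [e He].
  exists (function_program e), (fun x n => rv (mix U n x)). split; [|split].
  - intros x n. destruct (function_program_runs e (enc x) n) as (r & Hr & H0 & H1).
    assert (E : ev e (to_nat (enc x, n)) = to_nat (mix U n x)).
    { etransitivity; [exact (He (x, n))|].
      change (to_nat (fst (mix U n x), snd (mix U n x)) = to_nat (mix U n x)).
      now rewrite <- surjective_pairing. }
    rewrite E, cancel_of_to in H0, H1. exists r. rewrite H0, H1.
    split; [exact Hr | split; [apply mix_pos | reflexivity]].
  - intros x n. apply mix_mono. lia.
  - exact HS.
Qed.

(** * Prediction error *)

Lemma prefix_S w m : prefix w (S m) = prefix w m ++ [w m].
Proof. unfold prefix. now rewrite seq_S, map_app. Qed.

Lemma measure_snoc Q x : IsMeasure Q -> Q (x ++ [false]) + Q (x ++ [true]) = Q x.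
Proof. intro H. apply H. Qed.

Lemma measure_nonneg Q x : IsMeasure Q -> 0 <= Q x.
Proof. intro H. apply H. Qed.

Lemma measure_pos_prefix Q x b : IsMeasure Q -> 0 < Q (x ++ [b]) -> 0 < Q x.
Proof.
  intros H Hb. pose proof (measure_snoc Q x H).
  pose proof (measure_nonneg Q (x ++ [false]) H).
  pose proof (measure_nonneg Q (x ++ [true]) H). destruct b; lra.
Qed.

Lemma measure_pos_prefix_le Q w n m :
  IsMeasure Q -> (n <= m)%nat -> 0 < Q (prefix w m) -> 0 < Q (prefix w n).
Proof.
  intros HQ. induction 1; auto. rewrite prefix_S. intro H1.
  apply IHle. eapply measure_pos_prefix; eauto.
Qed.

Lemma computes_det q P Q x : computes q P -> computes q Q -> P x = Q x.
Proof.
  intros HP HQ. destruct (HP x) as (r & Hr & _ & ->). destruct (HQ x) as (r' & Hr' & _ & ->).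
  now rewrite (runs_det _ _ _ _ Hr Hr').
Qed.

Lemma val_computes q Q y : computes q Q -> exists n v, val n q y = Some v /\ rv v = Q y.
Proof.
  intro H. destruct (H y) as (r & Hr & H1 & ->). apply run_runs in Hr as [n Hn].
  exists n, (r 0%nat, r 1%nat). unfold val. rewrite Hn. simpl.
  destruct (r 1%nat); [lia|]. auto.
Qed.

(** For a genuine measure, positive at [y], every check succeeds once the three values have been
    computed. *)
Lemma cond_computes q Q y :
  computes q Q -> IsMeasure Q -> 0 < Q y ->
  exists n, forall b, exists c, cond n q y b = Some c /\ rv c = Q (y ++ [b]) / Q y.
Proof.
  intros H HQ Hy.
  destruct (val_computes q Q y H) as (n & v & Hv & Ev).
  destruct (val_computes q Q (y ++ [false]) H) as (n0 & v0 & Hv0 & Ev0).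
  destruct (val_computes q Q (y ++ [true]) H) as (n1 & v1 & Hv1 & Ev1).
  set (m := (n + n0 + n1)%nat). exists m.
  apply (val_mono n m) in Hv; [|unfold m; lia].
  apply (val_mono n0 m) in Hv0; [|unfold m; lia].
  apply (val_mono n1 m) in Hv1; [|unfold m; lia].
  unfold cond. rewrite Hv, Hv0, Hv1.
  apply val_pos in Hv, Hv0, Hv1. apply lt_0_INR in Hv, Hv0, Hv1.
  assert (Hc : consistent v v0 v1 = true).
  { apply Nat.eqb_eq, INR_eq. repeat rewrite ?mult_INR, ?plus_INR.
    pose proof (measure_snoc Q y HQ) as Hs. rewrite <- Ev, <- Ev0, <- Ev1 in Hs.
    unfold rv in Hs.
    apply (f_equal (fun t => t * (INR (snd v) * INR (snd v0) * INR (snd v1)))) in Hs.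
    field_simplify in Hs; [|lra..]. lra. }
  rewrite Hc. intro b.
  assert (Hk : 0 < INR (fst v)).
  { rewrite <- Ev in Hy. unfold rv in Hy. destruct (fst v) as [|k].
    - simpl in Hy. lra.
    - apply lt_0_INR. lia. }
  destruct (fst v) as [|k] eqn:E; [simpl in Hk; lra|].
  eexists. split; [reflexivity|].
  destruct b; [rewrite <- Ev1 | rewrite <- Ev0]; rewrite <- Ev; unfold rv; cbn [fst snd];
    rewrite E, !mult_INR; field; lra.
Qed.

(** The semimeasure A with mean conditional probabilities, evaluated along [w] only. *)
Fixpoint average (P Q : str -> R) (w : nat -> bool) (m : nat) : R :=
  match m with
  | O => 1
  | S m =>
      average P Q w m * ((P (prefix w (S m)) / P (prefix w m)
                          + Q (prefix w (S m)) / Q (prefix w m)) / 2)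
  end.

(** The product of conditional probabilities telescopes; this turns the diagonal terms of the
    mixture into the measures themselves. *)
Lemma average_self P w m :
  IsMeasure P -> 0 < P (prefix w m) -> average P P w m = P (prefix w m).
Proof.
  intros HP. induction m; intro H; [symmetry; apply HP|].
  assert (H' : 0 < P (prefix w m)) by (apply (measure_pos_prefix_le P w m (S m)); auto).
  simpl average. rewrite IHm by auto. field. lra.
Qed.

Lemma walk_computes q q' P Q w m :
  computes q P -> computes q' Q -> IsMeasure P -> IsMeasure Q ->
  0 < P (prefix w m) -> 0 < Q (prefix w m) ->
  exists n s, walk n (q, q') (prefix w m) = Some s /\ rv (snd s) = average P Q w m.
Proof.
  intros Hq Hq' HP HQ. induction m; intros H H'.
  - exists 0%nat. eexists. split; [reflexivity|]. unfold rv. simpl. lra.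
  - assert (HPm : 0 < P (prefix w m)) by (apply (measure_pos_prefix_le P w m (S m)); auto).
    assert (HQm : 0 < Q (prefix w m)) by (apply (measure_pos_prefix_le Q w m (S m)); auto).
    destruct (IHm HPm HQm) as (n & s & Hs & Es).
    destruct (cond_computes q P _ Hq HP HPm) as [n1 H1].
    destruct (cond_computes q' Q _ Hq' HQ HQm) as [n2 H2].
    destruct (H1 (w m)) as (c & Hc & Ec). destruct (H2 (w m)) as (c' & Hc' & Ec').
    set (k := (n + n1 + n2)%nat).
    apply (walk_mono n k) in Hs; [|unfold k; lia].
    apply (cond_mono n1 k) in Hc; [|unfold k; lia].
    apply (cond_mono n2 k) in Hc'; [|unfold k; lia].
    assert (Hx := proj1 (walk_inv _ _ _ _ Hs)).
    eassert (Ht : walk k (q, q') (prefix w (S m)) = Some _).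
    { rewrite prefix_S, walk_snoc, Hs. unfold walk_step. cbn [fst snd]. rewrite Hx, Hc, Hc'.
      reflexivity. }
    exists k. eexists. split; [exact Ht|]. rewrite prefix_S in Ht.
    destruct (walk_step_value _ _ _ _ _ _ Hs Ht) as (d & d' & Hd & Hd' & ->).
    cbn [fst snd] in Hd, Hd'. rewrite Hc in Hd. rewrite Hc' in Hd'.
    injection Hd as <-. injection Hd' as <-.
    simpl average. rewrite prefix_S. now rewrite Es, Ec, Ec'.
Qed.

Lemma outputs_run U p y :
  outputs U p y -> exists n v, run U (enc p) n = Some (enc y, v).
Proof.
  intros (r & Hr & H0). apply run_runs in Hr as [n Hn]. exists n, (r 1%nat).
  now rewrite Hn, H0.
Qed.

Lemma mixture_ge U V p p' q q' P Q w m :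
  is_mixture U V -> outputs U p q -> outputs U p' q' ->
  computes q P -> computes q' Q -> IsMeasure P -> IsMeasure Q ->
  0 < P (prefix w m) -> 0 < Q (prefix w m) ->
  average P Q w m / (2 * INR (weight (p, p'))) <= V (prefix w m).
Proof.
  intros HS Hp Hp' Hq Hq' HP HQ H H'.
  apply outputs_run in Hp as (n & v & Hn). apply outputs_run in Hp' as (n' & v' & Hn').
  destruct (walk_computes q q' P Q w m Hq Hq' HP HQ H H') as (n0 & s & Hs & <-).
  set (x := prefix w m) in *.
  (* Large enough for all computations to halt and for both indices [enc p] and [enc p'] to enter
     the double sum, of which one term is kept. *)
  set (k := S (n + n' + n0 + enc p + enc p')%nat).
  apply (run_mono _ _ n k) in Hn; [|unfold k; lia].
  apply (run_mono _ _ n' k) in Hn'; [|unfold k; lia].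
  apply (walk_mono n0 k) in Hs; [|unfold k; lia].
  apply Rle_trans with (rv (mix U k x)); [|apply (HS x); now exists k].
  assert (E : rv (term U k (p, p') x) = rv (snd s) / INR (weight (p, p'))).
  { rewrite rv_term. unfold walk_of. cbn [fst snd]. rewrite Hn, Hn'. cbn [fst].
    now rewrite !dec_enc, Hs. }
  replace (rv (snd s) / (2 * INR (weight (p, p'))))
    with (/ 2 * (rv (snd s) / INR (weight (p, p'))))
    by (unfold Rdiv; rewrite Rinv_mult; lra).
  rewrite rv_mix, <- E. apply Rmult_le_compat_l; [lra|].
  eapply Rle_trans; [|apply (fsum_ge_term _ k (enc p))].
  - cbv beta. rewrite <- (dec_enc p') at 1. rewrite <- (dec_enc p) at 1.
    apply (fsum_ge_term (fun j => rv (term U k (dec (enc p), dec j) x))).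
    + intro. apply rv_nonneg.
    + unfold k. lia.
  - intro. apply fsum_nonneg. intro. apply rv_nonneg.
  - unfold k. lia.
Qed.

(** * Accumulated deviation against logarithms of probabilities *)

Lemma ln_le_sub x : 0 < x -> ln x <= x - 1.
Proof.
  intro H. pose proof (exp_ineq1_le (ln x)) as E. rewrite exp_ln in E; lra.
Qed.

(** With m the mean, [m^2 - a b = (a - b)^2 / 4]; so [ln (a b / m^2) <= a b / m^2 - 1 = - (a - b)^2
    / (4 m^2)], and [m <= 1] removes the denominator. *)
Lemma ln_mean a b :
  0 < a <= 1 -> 0 < b <= 1 -> (a - b) ^ 2 / 4 <= 2 * ln ((a + b) / 2) - ln a - ln b.
Proof.
  intros Ha Hb. set (m := (a + b) / 2). assert (Hm : 0 < m <= 1) by (unfold m; lra).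
  assert (E : ln a + ln b - 2 * ln m = ln (a * b / (m * m))).
  { assert (0 < a * b) by (apply Rmult_lt_0_compat; lra).
    assert (0 < m * m) by (apply Rmult_lt_0_compat; lra).
    unfold Rdiv. rewrite ln_mult, ln_Rinv, !ln_mult; auto using Rinv_0_lt_compat; lra. }
  assert (H : ln (a * b / (m * m)) <= a * b / (m * m) - 1).
  { apply ln_le_sub. apply Rdiv_lt_0_compat; apply Rmult_lt_0_compat; lra. }
  assert (H' : a * b / (m * m) - 1 <= - ((a - b) ^ 2 / 4)).
  { replace (a * b / (m * m) - 1) with (- ((a - b) ^ 2 / 4 * / (m * m)))
      by (unfold m; field; lra).
    apply Ropp_le_contravar. rewrite <- (Rmult_1_r ((a - b) ^ 2 / 4)) at 1.
    pose proof (pow2_ge_0 (a - b)). apply Rmult_le_compat_l; [lra|].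
    rewrite <- Rinv_1. apply Rinv_le_contravar; nra. }
  lra.
Qed.

Definition gap (P Q : str -> R) (w : nat -> bool) (n : nat) : R :=
  (Q (prefix w n ++ [false]) / Q (prefix w n)
   - P (prefix w n ++ [false]) / P (prefix w n)) ^ 2.

Lemma cond_prob Q x b :
  IsMeasure Q -> 0 < Q x -> 0 <= Q (x ++ [b]) / Q x <= 1 /\
  Q (x ++ [true]) / Q x = 1 - Q (x ++ [false]) / Q x.
Proof.
  intros HQ Hx. pose proof (measure_snoc Q x HQ) as Hs.
  pose proof (measure_nonneg Q (x ++ [false]) HQ).
  pose proof (measure_nonneg Q (x ++ [true]) HQ).
  assert (Hi := Rinv_0_lt_compat _ Hx).
  assert (E : (Q (x ++ [false]) + Q (x ++ [true])) * / Q x = 1)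
    by (rewrite Hs; field; lra).
  rewrite Rmult_plus_distr_r in E. unfold Rdiv.
  assert (0 <= Q (x ++ [false]) * / Q x) by (apply Rmult_le_pos; lra).
  assert (0 <= Q (x ++ [true]) * / Q x) by (apply Rmult_le_pos; lra).
  destruct b; lra.
Qed.

Lemma gap_le_1 P Q w n :
  IsMeasure P -> IsMeasure Q -> 0 < P (prefix w n) -> 0 < Q (prefix w n) ->
  0 <= gap P Q w n <= 1.
Proof.
  intros HP HQ H H'. unfold gap.
  destruct (cond_prob P _ false HP H) as [E _].
  destruct (cond_prob Q _ false HQ H') as [E' _].
  split; [apply pow2_ge_0|]. simpl. rewrite Rmult_1_r. nra.
Qed.

(** The two outcomes deviate by opposite amounts, so the gap can be measured
    at the symbol of [w] itself. *)
Lemma gap_sum P Q w m :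
  IsMeasure P -> IsMeasure Q -> 0 < P (prefix w m) -> 0 < Q (prefix w m) ->
  0 < average P Q w m /\
  fsum (gap P Q w) m / 4
  <= 2 * ln (average P Q w m) - ln (P (prefix w m)) - ln (Q (prefix w m)).
Proof.
  intros HP HQ. induction m; intros H H'.
  - simpl. change (prefix w 0) with (@nil bool).
    rewrite (proj1 HP), (proj1 HQ), ln_1. lra.
  - assert (HPm : 0 < P (prefix w m)) by (apply (measure_pos_prefix_le P w m (S m)); auto).
    assert (HQm : 0 < Q (prefix w m)) by (apply (measure_pos_prefix_le Q w m (S m)); auto).
    destruct (IHm HPm HQm) as [Ha IH].
    set (a := P (prefix w (S m)) / P (prefix w m)).
    set (b := Q (prefix w (S m)) / Q (prefix w m)).
    assert (Ga : 0 < a) by now apply Rdiv_lt_0_compat.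
    assert (Gb : 0 < b) by now apply Rdiv_lt_0_compat.
    destruct (cond_prob P _ (w m) HP HPm) as [La Ea].
    destruct (cond_prob Q _ (w m) HQ HQm) as [Lb Eb].
    rewrite <- prefix_S in La, Lb. fold a in La. fold b in Lb.
    assert (Eg : gap P Q w m = (a - b) ^ 2).
    { unfold gap, a, b. rewrite prefix_S. destruct (w m); [rewrite Ea, Eb|]; ring. }
    assert (Ep : ln (P (prefix w (S m))) = ln (P (prefix w m)) + ln a).
    { rewrite <- ln_mult by auto. f_equal. unfold a. field. lra. }
    assert (Eq : ln (Q (prefix w (S m))) = ln (Q (prefix w m)) + ln b).
    { rewrite <- ln_mult by auto. f_equal. unfold b. field. lra. }
    simpl average. fold a b. split; [apply Rmult_lt_0_compat; lra|].
    rewrite ln_mult, Ep, Eq by lra. rewrite fsum_S, Eg.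
    pose proof (ln_mean a b). lra.
Qed.

(** If a prefix x had measure 0, the test whose levels all equal {x} would be a Martin-Löf test, and
    [w] would fail it at every level. *)
Lemma MLRandom_pos P w m : IsMeasure P -> MLRandom P w -> 0 < P (prefix w m).
Proof.
  intros HP Hw. destruct (measure_nonneg P (prefix w m) HP) as [|E]; auto. exfalso.
  set (x := prefix w m) in *.
  assert (HF : PR (fun t : nat * nat => Nat.eqb (snd t) (enc x))) by pr_auto.
  destruct HF as [e He].
  assert (Hin : forall n y, inW (domain_program e) n y <-> y = x).
  { intros n y. unfold inW. rewrite domain_program_halts.
    assert (He' : ev e (to_nat (n, enc y)) = code (Nat.eqb (enc y) (enc x)))
      by exact (He (n, enc y)).
    rewrite He'. unfold code, code_bool.
    destruct (Nat.eqb_spec (enc y) (enc x)) as [Hxy|Hxy].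
    - split; [intros _; now apply enc_inj | discriminate].
    - split; [congruence | intros ->; congruence]. }
  destruct (Hw (domain_program e)) as [n Hn].
  - intros n L _ _ HL.
    assert (Z : fold_right Rplus 0 (map P L) = 0).
    { induction L as [|y L IH]; simpl; auto.
      rewrite IH by (intros; apply HL; now right).
      replace y with x by (symmetry; apply (Hin n), HL; now left). lra. }
    rewrite Z. apply pow_le. lra.
  - apply (Hn m). now apply Hin.
Qed.

(** * Binary logarithms, counting by programs and the final estimate *)

Lemma Rceil_bounds y : y <= IZR (Rceil y) < y + 1.
Proof.
  unfold Rceil. rewrite minus_IZR. destruct (archimed (- y)). lra.
Qed.

Lemma log2_le x y : 0 < x -> x <= y -> log2 x <= log2 y.
Proof.
  intros Hx Hxy. unfold log2. apply Rmult_le_compat_r.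
  - left. apply Rinv_0_lt_compat. rewrite <- ln_1. apply ln_increasing; lra.
  - destruct Hxy as [H| ->]; [left; now apply ln_increasing | apply Rle_refl].
Qed.

Lemma ln2_pos : 0 < ln 2.
Proof. rewrite <- ln_1. apply ln_increasing; lra. Qed.

Lemma log2_mult x y : 0 < x -> 0 < y -> log2 (x * y) = log2 x + log2 y.
Proof. intros Hx Hy. unfold log2. rewrite ln_mult by auto. lra. Qed.

Lemma log2_inv_pow n : log2 (/ 2 ^ n) = - INR n.
Proof.
  unfold log2. rewrite ln_Rinv, ln_pow by (try apply pow_lt; lra).
  pose proof ln2_pos. field. lra.
Qed.

(** Each index lies in exactly one class, so the sums may be exchanged. Below, the key is the code
    of the program of the best explanation. *)
Lemma fsum_classes f (key : nat -> nat) N T C :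
  (forall n, (n < N)%nat -> (key n < T)%nat) ->
  (forall i, (i < T)%nat -> fsum (fun n => if Nat.eqb (key n) i then f n else 0) N <= C) ->
  fsum f N <= INR T * C.
Proof.
  intros Hk HC. rewrite <- fsum_const.
  eapply Rle_trans; [|apply fsum_le, HC].
  rewrite fsum_exchange. apply Req_le, fsum_ext. intros n Hn.
  symmetry. now apply fsum_single, Hk.
Qed.

Lemma sum_f_R0_fsum f N : sum_f_R0 f N = fsum f (S N).
Proof.
  induction N; [simpl; lra|]. simpl sum_f_R0. now rewrite IHN.
Qed.

(** Turns a bound on program length into a bound on the number of programs. *)
Lemma enc_lt x : (enc x < 2 ^ S (length x))%nat.
Proof.
  enough (S (enc x) < 2 ^ S (length x))%nat by lia.
  induction x as [|b x IH]; [simpl; lia|].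
  rewrite enc_cons. simpl length. rewrite Nat.pow_succ_r'.
  destruct b; simpl Nat.b2n; lia.
Qed.

(** Two layers: [U] expands [p] into a counter program, which computes [Q]. Complexity and counting
    refer to [p]. *)
Definition program_of (U : str) (Q : str -> R) (p : str) : Prop :=
  exists q, outputs U p q /\ computes q Q.

Lemma outputs_det U p y y' : outputs U p y -> outputs U p y' -> y = y'.
Proof.
  intros (r & Hr & H) (r' & Hr' & H'). rewrite (runs_det _ _ _ _ Hr Hr') in H.
  apply enc_inj. congruence.
Qed.

Lemma program_of_det U p P Q x : program_of U P p -> program_of U Q p -> P x = Q x.
Proof.
  intros (q & H & HP) (q' & H' & HQ). rewrite (outputs_det _ _ _ _ H H') in HP.
  eapply computes_det; eauto.
Qed.

Lemma KMeasIs_program U Q k : KMeasIs U Q k -> exists p, program_of U Q p /\ length p = k.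
Proof.
  intros [(q & Hq & (p & Hp & Hl) & _) _]. exists p. split; auto. now exists q.
Qed.

(** The first logarithmic bound comes from the pair (p', p'), the second from (p, p'). *)
Definition dominates_mixture (U : str) (M : str -> R) (B : R) : Prop :=
  forall P Q p p' w m,
    program_of U P p -> program_of U Q p' -> IsMeasure P -> IsMeasure Q ->
    0 < P (prefix w m) -> 0 < Q (prefix w m) ->
    0 < M (prefix w m) /\
    log2 (Q (prefix w m)) - INR (length p') - B <= log2 (M (prefix w m)) /\
    log2 (average P Q w m) - INR (length p) - INR (length p') - B
      <= log2 (M (prefix w m)).

Lemma universal_bound U M :
  OptimalPrefix U -> UniversalSemimeasure M ->
  exists B, dominates_mixture U M B.
Proof.
  intros [HU _] (_ & _ & HM).
  destruct (mixture_exists U HU) as [V HV].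
  destruct (HM V) as (c & Hc & HMc);
    [now apply mixture_semimeasure with U | now apply mixture_lower_semicomputable with U|].
  (* [c] comes from universality, the 2 from the normalisation in [mix]. *)
  exists (- log2 (c / 2)). intros P Q p p' w m (q & Hp & Hq) (q' & Hp' & Hq') HP HQ H H'.
  set (x := prefix w m) in *.
  assert (Hpow : forall k, 0 < / 2 ^ k) by (intro; apply Rinv_0_lt_compat, pow_lt; lra).
  assert (Hgen : forall a k, 0 < a -> a / (2 * 2 ^ k) <= V x ->
    0 < M x /\ log2 a - INR k + log2 (c / 2) <= log2 (M x)).
  { intros a k Ha Hle.
    assert (E : c / 2 * (a * / 2 ^ k) <= M x).
    { eapply Rle_trans; [|apply HMc].
      replace (c / 2 * (a * / 2 ^ k)) with (c * (a / (2 * 2 ^ k))).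
      - apply Rmult_le_compat_l; lra.
      - field. apply pow_nonzero. lra. }
    assert (G : 0 < a * / 2 ^ k) by (apply Rmult_lt_0_compat; auto).
    assert (G' : 0 < c / 2 * (a * / 2 ^ k)) by (apply Rmult_lt_0_compat; lra).
    split; [lra|]. apply log2_le in E; auto.
    rewrite !log2_mult, log2_inv_pow in E; auto; lra. }
  assert (Hself : weight (p', p') = (2 ^ length p')%nat).
  { unfold weight. cbn [fst snd]. now rewrite Nat.eqb_refl. }
  assert (H2 : forall k, INR (2 ^ k) = 2 ^ k) by (intro; now rewrite pow_INR).
  (* Stated as an inequality to cover [p = p'], where the weight is larger and its reciprocal
     smaller. *)
  assert (Hw : INR (weight (p, p')) <= 2 ^ (length p + length p')).
  { unfold weight. cbn [fst snd]. destruct (Nat.eqb _ _); rewrite H2; [|lra].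
    apply Rle_pow; [lra | lia]. }
  pose proof (mixture_ge U V p' p' q' q' Q Q w m HV Hp' Hp' Hq' Hq' HQ HQ H' H') as B1.
  rewrite Hself, H2, average_self in B1 by auto.
  pose proof (mixture_ge U V p p' q q' P Q w m HV Hp Hp' Hq Hq' HP HQ H H') as B2.
  destruct (gap_sum P Q w m HP HQ H H') as [Ha _].
  destruct (Hgen _ _ H' B1) as [HMx E1]. split; auto. split; [lra|].
  destruct (Hgen (average P Q w m) (length p + length p')%nat Ha) as [_ E2].
  - eapply Rle_trans; [|exact B2]. unfold Rdiv. apply Rmult_le_compat_l; [lra|].
    pose proof (lt_0_INR _ (weight_pos (p, p'))).
    apply Rinv_le_contravar; lra.
  - rewrite plus_INR in E2. lra.
Qed.

Lemma Rpower2_succ r : 2 * Rpower 2 r = Rpower 2 (r + 1).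
Proof. rewrite Rpower_plus, Rpower_1; lra. Qed.

(** Write k for [length p']; the ceiling in [KA] gives [log M - log P <= D + 1]. Inserting
    [log Q <= log M + k + B] into the optimality of Q leaves [2 k] on the left. For the gaps,
    [2 log A - log P - log Q] is [2 (log A - log P) + (log P - log Q)], at most
    [2 (D + 1 + kP + k + B) + 3 kP - 3 k]; the remaining [- k] is dropped. *)
Lemma best_explanation_bounds U M B P w kP D x m Q p p' :
  dominates_mixture U M B ->
  x = prefix w m ->
  program_of U P p -> length p = kP -> IsMeasure P -> 0 < P x ->
  program_of U Q p' -> IsMeasure Q -> 0 < Q x ->
  defic M P x <= D ->
  3 * INR (length p') - log2 (Q x) <= 3 * INR kP - log2 (P x) ->
  2 * INR (length p') <= 3 * INR kP + D + 1 + B /\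
  fsum (gap P Q w) m <= 4 * Rmax 0 (2 * D + 5 * INR kP + 2 + 2 * B).
Proof.
  intros HB -> Hp Hl HP HPx Hp' HQ HQx HD Hbest.
  destruct (HB P Q p p' w m Hp Hp' HP HQ HPx HQx) as (HMx & E1 & E2).
  rewrite Hl in E2.
  assert (HD' : - log2 (P (prefix w m)) + log2 (M (prefix w m)) - 1 <= D).
  { unfold defic, KA in HD. pose proof (Rceil_bounds (- log2 (M (prefix w m)))). lra. }
  split; [lra|].
  destruct (gap_sum P Q w m HP HQ HPx HQx) as [Ha Hs].
  set (k := INR (length p')) in *. assert (Hk : 0 <= k) by apply pos_INR.
  set (X := 2 * D + 5 * INR kP + 2 + 2 * B).
  assert (HX : 2 * log2 (average P Q w m) - log2 (P (prefix w m)) - log2 (Q (prefix w m)) <= X)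
    by (unfold X; lra).
  assert (Hln : fsum (gap P Q w) m / 4 <= ln 2 * X).
  { eapply Rle_trans; [exact Hs|]. pose proof ln2_pos.
    apply (Rmult_le_compat_l (ln 2)) in HX; [|lra].
    eapply Rle_trans; [|exact HX]. unfold log2. apply Req_le. field. lra. }
  (* The maximum with 0 permits replacing the factor [ln 2] by 1 whatever the sign of [X]. *)
  pose proof (Rmax_l 0 X). pose proof (Rmax_r 0 X). pose proof ln2_pos.
  pose proof (ln_le_sub 2). nra.
Qed.

Theorem theorem7 :
  forall (U : str) (M : str -> R),
    OptimalPrefix U -> UniversalSemimeasure M ->
    exists c1 c2 : R,
      forall (P : str -> R) (w : nat -> bool) (kP : nat) (D : R)
             (H : str -> str -> R),
        ComputableMeasure P ->
        MLRandom P w ->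
        KMeasIs U P kP ->
        is_lub (fun r => exists n, r = defic M P (prefix w n)) D ->
        (forall x, BestExplanation U x (H x)) ->
        forall N : nat,
          sum_f_R0 (fun n =>
              (H (prefix w n) (prefix w n ++ [false]) / H (prefix w n) (prefix w n)
               - P (prefix w n ++ [false]) / P (prefix w n)) ^ 2) N
          <= c1 * (INR kP + D + c2) * Rpower 2 ((3 * INR kP + D + c2) / 2).
Proof.
  intros U M HU HM. destruct (universal_bound U M HU HM) as [B HB].
  (* The deficiency of the empty word exceeds [d0], so [D >= d0]. As [D] may be negative, [c2]
     contains [Rabs d0] to keep [INR kP + D + c2] positive. *)
  set (d0 := log2 (M []) - 1).
  (* 40 is 2 * 20: the 2 from [2 ^ S m], the 20 from the coefficient 5 of [kP] times the 4 of the
     gap bound. *)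
  exists 40, (Rabs d0 + 2 * Rabs (1 + B) + 1).
  intros P w kP D H [HP _] Hw HkP [HD _] HH N.
  destruct (KMeasIs_program U P kP HkP) as (p & Hp & Hl).
  assert (Ppos : forall n, 0 < P (prefix w n)) by (intro; now apply MLRandom_pos).
  assert (HDn : forall n, defic M P (prefix w n) <= D) by (intro n; apply HD; now exists n).
  assert (Hex : forall n, exists p', program_of U (H (prefix w n)) p' /\
    3 * INR (length p') - log2 (H (prefix w n) (prefix w n))
      <= 3 * INR kP - log2 (P (prefix w n))).
  { intro n. destruct (HH (prefix w n)) as (_ & _ & kQ & HkQ & Hbest).
    destruct (KMeasIs_program U _ _ HkQ) as (p' & Hp' & Hl').
    exists p'. split; auto. rewrite Hl'. apply Hbest; auto.
    split; [exact HP|]. destruct Hp as (q & _ & Hq). now exists q. }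
  (* One shortest program per prefix is fixed, since the classes need a key function. *)
  set (pr n := proj1_sig (constructive_indefinite_description _ (Hex n))).
  assert (Hpr : forall n, program_of U (H (prefix w n)) (pr n) /\
    3 * INR (length (pr n)) - log2 (H (prefix w n) (prefix w n))
      <= 3 * INR kP - log2 (P (prefix w n))).
  { intro n. unfold pr. apply proj2_sig. }
  clearbody pr. clear Hex.
  assert (Qm : forall n, IsMeasure (H (prefix w n)))
    by (intro n; destruct (HH (prefix w n)) as ([? _] & _); auto).
  assert (Qpos : forall n, 0 < H (prefix w n) (prefix w n))
    by (intro n; now destruct (HH (prefix w n)) as (_ & ? & _)).
  assert (Hbounds := fun n => best_explanation_bounds U M B P w kP D (prefix w n) n
    (H (prefix w n)) p (pr n) HB eq_refl Hp Hl HP (Ppos n) (proj1 (Hpr n)) (Qm n) (Qpos n)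
    (HDn n) (proj2 (Hpr n))).
  set (c2 := Rabs d0 + 2 * Rabs (1 + B) + 1).
  set (X := Rmax 0 (2 * D + 5 * INR kP + 2 + 2 * B)) in *.
  pose proof (pos_INR kP) as HkP0.
  assert (HDd : d0 <= D).
  { pose proof (HDn 0%nat) as E. unfold defic, KA in E. change (prefix w 0) with (@nil bool) in E.
    rewrite (proj1 HP) in E. pose proof (Rceil_bounds (- log2 (M []))).
    assert (log2 1 = 0) by (unfold log2; rewrite ln_1; lra). unfold d0. lra. }
  pose proof (Rle_abs (- d0)) as A1. rewrite Rabs_Ropp in A1.
  pose proof (Rle_abs (1 + B)) as A2. pose proof (Rabs_pos d0) as A3.
  pose proof (Rabs_pos (1 + B)) as A4.
  (* The 1 is for the last index of a class, whose own deviation its explanation does not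
     control. *)
  set (C := 4 * X + 1).
  assert (HC : 0 <= C <= 20 * (INR kP + D + c2)).
  { unfold C, X, c2. pose proof (Rmax_l 0 (2 * D + 5 * INR kP + 2 + 2 * B)).
    split; [lra|]. apply (Rmax_case _ _ (fun r => 4 * r + 1 <= _)); lra. }
  (* [m] is the length of a program actually used, so it inherits the real bound without rounding;
     index 0 provides the start. *)
  assert (HT : exists m, (forall n, (n < S N)%nat -> (length (pr n) <= m)%nat) /\
                2 * INR m <= 3 * INR kP + D + 1 + B).
  { induction (S N) as [|n (m & Hm & Hb)].
    - exists (length (pr 0%nat)). split; [lia|]. apply (Hbounds 0%nat).
    - destruct (Nat.le_gt_cases (length (pr n)) m) as [L|L].
      + exists m. split; auto. intros i Hi.
        destruct (Nat.eq_dec i n) as [->|]; auto. apply Hm. lia.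
      + exists (length (pr n)). split; [|apply (Hbounds n)]. intros i Hi.
        destruct (Nat.eq_dec i n) as [->|]; auto. specialize (Hm i). lia. }
  destruct HT as (m & Hm & Hmb).
  rewrite sum_f_R0_fsum.
  apply Rle_trans with (INR (2 ^ S m) * C).
  - apply (fsum_classes _ (fun n => enc (pr n))).
    + intros n Hn. eapply Nat.lt_le_trans; [apply enc_lt|].
      apply Nat.pow_le_mono_r; [lia|]. specialize (Hm n Hn). lia.
    (* When index [n] belongs to the class, it is the last one so far: its explanation bounds all
       earlier members at once, and the induction hypothesis serves otherwise. *)
    + intros i _. clear Hm. induction (S N) as [|n IH]; [simpl; lra|].
      rewrite fsum_S. destruct (Nat.eqb_spec (enc (pr n)) i) as [<-|]; [|lra].
      change ((H (prefix w n) (prefix w n ++ [false]) / H (prefix w n) (prefix w n) -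
        P (prefix w n ++ [false]) / P (prefix w n)) ^ 2) with (gap P (H (prefix w n)) w n).
      pose proof (gap_le_1 P _ w n HP (Qm n) (Ppos n) (Qpos n)).
      enough (fsum (fun j => if Nat.eqb (enc (pr j)) (enc (pr n))
                             then gap P (H (prefix w j)) w j else 0) n <= 4 * X)
        by (unfold C, gap in *; lra).
      eapply Rle_trans; [|apply (proj2 (Hbounds n))].
      (* A member [j] of the class shares the program of [n], hence its measure; at the other
         indices 0 is replaced by a nonnegative gap. *)
      apply fsum_le. intros j Hj.
      destruct (Nat.eqb_spec (enc (pr j)) (enc (pr n))) as [E|_].
      * apply enc_inj in E. unfold gap.
        rewrite !(program_of_det U (pr n) (H (prefix w j)) (H (prefix w n)));
          [lra | try apply Hpr ..]; rewrite <- E; apply Hpr.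
      * apply pow2_ge_0.
  - rewrite pow_INR. replace (INR 2) with 2 by reflexivity.
    rewrite <- Rpower_pow, S_INR, <- Rpower2_succ by lra.
    assert (E : Rpower 2 (INR m) <= Rpower 2 ((3 * INR kP + D + c2) / 2)).
    { apply Rle_Rpower; [lra|]. unfold c2. lra. }
    assert (0 < Rpower 2 (INR m)) by apply exp_pos.
    nra.
Qed.
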